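(* The subgraph induced in $\Lambda(2)$ by the pentagons and the hexagons (the lattice polygons with $5$ or $6$ vertices) is connected.
   Context: A lattice polygon is a $2$-dimensional convex polygon in $\mathbb{R}^2$ whose vertices all belong to $\mathbb{Z}^2$. Let $P\subset\mathbb{R}^2$ be a $2$-dimensional polygon with vertex set $\mathcal{V}$. A point $x\in\mathbb{R}^2\setminus P$ can be inserted in $P$ if the vertex set of the convex hull of $P\cup\{x\}$ is exactly $\mathcal{V}\cup\{x\}$; the insertion move then replaces $P$ by this convex hull. A vertex $v\in\mathcal{V}$ can be deleted from $P$ if the convex hull of $\mathcal{V}\setminus\{v\}$ is still $2$-dimensional; the deletion move then replaces $P$ by this convex hull. $\Lambda(2)$ is the undirected graph whose vertices are all the ($2$-dimensional) lattice polygons in $\mathbb{R}^2$ and whose edges connect two lattice polygons when one is obtained from the other by a single insertion move (equivalently, the other by a single deletion move). *)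

(* Defs.v *)
From Stdlib Require Export Relation_Operators.
From mathcomp Require Export all_boot all_order all_algebra.
From mathcomp Require Export all_classical all_reals.
From mathcomp Require Export interval_inference convex.

Set Implicit Arguments.
Unset Strict Implicit.
Unset Printing Implicit Defensive.

Import Order.TTheory GRing.Theory Num.Theory.

Local Open Scope classical_set_scope.
Local Open Scope card_scope.
Local Open Scope ring_scope.
Local Open Scope convex_scope.

(* Undirected graphs: [adj] is meant to be symmetric and to relate nodes only;
   this is the case for [Lambda2] below and is preserved by [induced]. *)
Record graph (T : Type) := Graph {
  nodes : set T;
  adj : T -> T -> Prop
}.

Definition induced (T : Type) (G : graph T) (S : set T) : graph T :=
  Graph (nodes G `&` S) (fun x y => [/\ S x, S y & adj G x y]).

(* Nonempty, and any two nodes are joined by a path. *)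
Definition connected_graph (T : Type) (G : graph T) : Prop :=
  nodes G !=set0 /\
  forall x y, nodes G x -> nodes G y -> clos_refl_trans T (adj G) x y.

Section Polygons.
Variable R : realType.

Local Notation plane := 'rV[R]_2.

Definition convex_hull (A : set plane) : set plane :=
  smallest (@convex_set R plane) A.

Definition two_dimensional (A : set plane) : Prop :=
  exists a b c, [/\ A a, A b, A c & row_free (col_mx (b - a) (c - a))].

(* Convex polygons, always of dimension 2 here. *)
Definition polygon (P : set plane) : Prop :=
  (exists2 A : set plane, finite_set A & P = convex_hull A) /\
  two_dimensional P.

(* The vertices of P are its extreme points. *)
Definition vertices (P : set plane) : set plane :=
  [set x | P x /\
    forall (y z : convex_lmodType plane) (t : {i01 R}),
      P y -> P z -> 0 < t%:num < 1 -> x = y <| t |> z -> y = x /\ z = x].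

Definition integer_lattice : set plane :=
  range (map_mx intr : 'rV[int]_2 -> plane).

Definition lattice_polygon (P : set plane) : Prop :=
  polygon P /\ vertices P `<=` integer_lattice.

Definition can_insert (P : set plane) (x : plane) : Prop :=
  ~ P x /\ vertices (convex_hull (P `|` [set x])) = vertices P `|` [set x].

Definition insertion_move (P Q : set plane) : Prop :=
  exists2 x, can_insert P x & Q = convex_hull (P `|` [set x]).

Definition Lambda2 : graph (set plane) :=
  Graph lattice_polygon
    (fun P Q => [/\ lattice_polygon P, lattice_polygon Q &
                    insertion_move P Q \/ insertion_move Q P]).

Definition has_n_vertices (n : nat) : set (set plane) :=
  [set P | vertices P #= `I_n].

End Polygons.

Arguments has_n_vertices {R} n.

(* Main.v *)
From Stdlib Require Import ZArith Lia.
Require Import Defs.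
From mathcomp Require Import ssrZ.

(** A lattice polygon is encoded by the counterclockwise list of its vertices, a
    list of integral points all of whose triples have positive determinant
    ([ccw]).  Since every hexagon contains a pentagon, it is enough to join any two
    pentagons, where a step inserts a lattice point and then deletes another vertex
    ([linked]).  The proof is a descent on the area, up to the group of unimodular
    affine maps, which acts on the whole situation.

    Descent.  Two of the five vertices have the same parity, which provides an
    interior lattice point ([interior_point]); some edge is such that the
    reflection of this point in its midpoint can be inserted beyond that edge
    ([facing_edge]).  Put the edge on the horizontal axis, from [(0, 0)] to
    [(l, 0)].  Then a lattice point at height [-1] can be inserted too, and it
    cuts the small ear [l] only ([reducible_above]).  Deleting a vertex with a
    larger ear decreases the area.  If there is no such vertex, the relation
    between the ears of a pentagon leaves few possible heights for the other
    vertices ([stuck_shape]), and in each of these families another insertion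
    decreases the area, apart from five pentagons.  Four of them lead to a smaller
    area in two steps; the last one is the smallest pentagon [base].

    Unimodular images.  Hence every pentagon is joined to an image of [base].  The
    unimodular maps [g] for which [base] is joined to its image by [g] form a
    group, and explicit walks show that it contains generators of the group of all
    unimodular affine maps ([fixes_unimodular]).

    Geometry.  The hull of a [ccw] list is a polygon whose vertices are the listed
    points, because an affine function exposes each of them
    ([first_point_vertex]).  Conversely, a polygon is the hull of its vertices
    ([convex_hull_vertices]), and sorting the vertices by angle around the
    lexicographically least one yields a [ccw] list ([ccw_enumeration]). *)

Set Implicit Arguments.
Unset Strict Implicit.
Unset Printing Implicit Defensive.

(** * Lattice points in convex position *)

Section ConvexPosition.
Local Open Scope Z_scope.

Local Arguments Z.add : simpl never.
Local Arguments Z.sub : simpl never.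
Local Arguments Z.mul : simpl never.

Definition pt := (Z * Z)%type.

Definition det (a b c : pt) : Z :=
  (b.1 - a.1) * (c.2 - a.2) - (b.2 - a.2) * (c.1 - a.1).

Fixpoint ccw (s : seq pt) : bool :=
  if s is a :: t then pairwise (fun b c => 0 <? det a b c) t && ccw t else true.

Definition pentagon (s : seq pt) := ccw s && (size s == 5%N).

Lemma detC a b c : det a b c = det b c a.
Proof. rewrite /det; lia. Qed.

Ltac split_ands := repeat match goal with
  | H : is_true (_ && _) |- _ => case/andP: H => ? ?
  | H : _ /\ _ |- _ => destruct H
  end.

Lemma ccw5P a b c d e : ccw [:: a; b; c; d; e] <->
  (0 < det a b c /\ 0 < det a b d /\ 0 < det a b e /\ 0 < det a c d /\
   0 < det a c e /\ 0 < det a d e /\ 0 < det b c d /\ 0 < det b c e /\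
   0 < det b d e /\ 0 < det c d e).
Proof.
split=> /= H; split_ands; first by repeat split; apply/Z.ltb_lt.
by rewrite !(proj2 (Z.ltb_lt _ _)).
Qed.

Lemma ccw6P a b c d e f : ccw [:: a; b; c; d; e; f] <->
  (0 < det a b c /\ 0 < det a b d /\ 0 < det a b e /\ 0 < det a b f /\
   0 < det a c d /\ 0 < det a c e /\ 0 < det a c f /\ 0 < det a d e /\
   0 < det a d f /\ 0 < det a e f) /\ ccw [:: b; c; d; e; f].
Proof.
rewrite (_ : ccw (a :: _) = pairwise (fun x y => 0 <? det a x y) [:: b; c; d; e; f]
  && ccw [:: b; c; d; e; f]) //; split=> [/andP[/= H ->]|[H ->]]; split_ands.
  by repeat split; apply/Z.ltb_lt.
by rewrite /= !(proj2 (Z.ltb_lt _ _)).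
Qed.

Lemma ccw_rcons s a :
  ccw (rcons s a) = ccw s && pairwise (fun b c => 0 <? det a b c) s.
Proof.
elim: s => //= b s ->; rewrite pairwise_rcons.
have -> : all ((fun c d => 0 <? det b c d)^~ a) s = all (fun c => 0 <? det a b c) s.
  by apply: eq_all => c /=; rewrite [det a b c]detC.
by case: ccw; case: pairwise; case: pairwise; case: all.
Qed.

Lemma ccw_rot n s : ccw (rot n s) = ccw s.
Proof.
elim: n s => [|n IHn] s; first by rewrite rot0.
case: (ltnP n (size s)) => [lt_ns|le_sn]; last by rewrite rot_oversize // ltnW.
rewrite rotS // -[RHS]IHn; case: (rot n s) => // a t.
by rewrite rot1_cons ccw_rcons andbC.
Qed.

(** The three-term Plücker relation for the vectors issued from [o]; it yields all
    the orientations below from the few that are assumed. *)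
Lemma plucker o a b c d :
  det o a c * det o b d = det o a b * det o c d + det o a d * det o b c.
Proof. rewrite /det; ring. Qed.

Lemma fan_pos_left o a b c d : 0 < det o b d ->
  0 < det o a b -> 0 < det o c d -> 0 < det o a d -> 0 < det o b c ->
  0 < det o a c.
Proof. have := plucker o a b c d; nia. Qed.

Lemma fan_pos_right o a b c d : 0 < det o a c ->
  0 < det o a b -> 0 < det o c d -> 0 < det o a d -> 0 < det o b c ->
  0 < det o b d.
Proof. have := plucker o a b c d; nia. Qed.

Ltac rotdet :=
  solve [assumption | rewrite detC; assumption | rewrite -detC; assumption].

(** The region beyond the edge [a b] and between the lines of the two neighboring
    edges is exactly where a vertex can be inserted: every other triple through
    [x] gets its sign from a Plücker relation with positive terms. *)
Lemma ccw_insert a b c d e x : ccw [:: a; b; c; d; e] ->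
  0 < det a x b -> 0 < det e a x -> 0 < det x b c ->
  ccw [:: a; x; b; c; d; e].
Proof.
move=> abcde axb eax xbc; have /ccw5P H := abcde; split_ands.
have axc : 0 < det a x c by apply: (@fan_pos_left _ _ b c e); rotdet.
have axd : 0 < det a x d by apply: (@fan_pos_left _ _ b d e); rotdet.
have bdx : 0 < det b d x by apply: (@fan_pos_right _ c d a x); rotdet.
have bex : 0 < det b e x by apply: (@fan_pos_right _ c e a x); rotdet.
have cdx : 0 < det c d x by apply: (@fan_pos_left _ d a x b); rotdet.
have cex : 0 < det c e x by apply: (@fan_pos_left _ e a x b); rotdet.
have dex : 0 < det d e x by apply: (@fan_pos_left _ e a x b); rotdet.
apply/ccw6P; split; first by repeat split; rotdet.
by apply/ccw5P; repeat split; rotdet.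
Qed.

Lemma subseq_ccw s t : subseq s t -> ccw t -> ccw s.
Proof.
elim: t s => [|b t IHt] [|a s] //= sub /andP[pt ct].
case: eqP sub => [-> sub|_ sub]; last exact: IHt sub ct.
by rewrite (subseq_pairwise sub pt) (IHt _ sub ct).
Qed.

(** * Moves between lattice pentagons, up to unimodular affine maps *)

(** Two pentagons are linked through a convex hexagon containing both.  Allowing
    [h] to have five points links the rotations of a pentagon to one another. *)
Definition linked (s t : seq pt) : Prop :=
  [/\ pentagon s, pentagon t &
      exists2 h, ccw h && (size h <= 6)%N & {subset s <= h} /\ {subset t <= h}].

Definition joined : seq pt -> seq pt -> Prop := clos_refl_trans (seq pt) linked.

Lemma linked_sym s t : linked s t -> linked t s.
Proof. by move=> [Ps Pt [h Hh [sh th]]]; split=> //; exists h. Qed.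

Lemma joined_sym s t : joined s t -> joined t s.
Proof.
elim=> [u v /linked_sym uv|u|u v w _ vu _ wv]; first exact: rt_step.
  exact: rt_refl.
exact: rt_trans wv vu.
Qed.

Lemma pentagon_linked s t : pentagon s -> pentagon t -> {subset s <= t} ->
  linked s t.
Proof.
move=> Ps Pt st; split=> //; exists t; last by split.
by case/andP: Pt => -> /eqP ->.
Qed.

Record aff := Aff { xx : Z; xy : Z; yx : Z; yy : Z; x0 : Z; y0 : Z }.

Definition act g (p : pt) : pt :=
  (xx g * p.1 + xy g * p.2 + x0 g, yx g * p.1 + yy g * p.2 + y0 g).

Definition adet g := xx g * yy g - xy g * yx g.

Definition unimodular g := adet g = 1 \/ adet g = -1.

Definition comp g h := Aff
  (xx g * xx h + xy g * yx h) (xx g * xy h + xy g * yy h)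
  (yx g * xx h + yy g * yx h) (yx g * xy h + yy g * yy h)
  (xx g * x0 h + xy g * y0 h + x0 g) (yx g * x0 h + yy g * y0 h + y0 g).

Definition inv g := let d := adet g in Aff
  (d * yy g) (- d * xy g) (- d * yx g) (d * xx g)
  (d * (xy g * y0 g - yy g * x0 g)) (d * (yx g * x0 g - xx g * y0 g)).

(** Orientation reversing maps also reverse the list, so that convex position
    in counterclockwise order is preserved. *)
Definition img g (s : seq pt) :=
  if 0 <? adet g then map (act g) s else rev (map (act g) s).

Lemma adet_comp g h : adet (comp g h) = adet g * adet h.
Proof. rewrite /adet /=; ring. Qed.

Lemma unimodular_comp g h :
  unimodular g -> unimodular h -> unimodular (comp g h).
Proof. by rewrite /unimodular adet_comp => -[] -> [] ->; lia. Qed.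

Lemma adet_inv g : unimodular g -> adet (inv g) = adet g.
Proof.
move=> Ug; have -> : adet (inv g) = adet g * adet g * adet g.
  rewrite {1}/adet /inv /=; rewrite /adet; ring.
by case: Ug => ->.
Qed.

Lemma unimodular_inv g : unimodular g -> unimodular (inv g).
Proof. by move=> Ug; rewrite /unimodular adet_inv. Qed.

Lemma act_comp g h p : act (comp g h) p = act g (act h p).
Proof. rewrite /act /=; congr (_, _); ring. Qed.

Lemma act_inv g p : unimodular g -> act (inv g) (act g p) = p.
Proof.
move=> Ug; have d2 : adet g * adet g = 1 by case: Ug => ->.
case: p => x y; rewrite /act /inv /=; congr (_, _).
  by transitivity (adet g * adet g * x); [rewrite /adet; ring | rewrite d2; ring].
by transitivity (adet g * adet g * y); [rewrite /adet; ring | rewrite d2; ring].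
Qed.

Lemma img_comp g h s : unimodular g -> unimodular h ->
  img (comp g h) s = img g (img h s).
Proof.
move=> Ug Uh; rewrite /img adet_comp.
have E : map (act (comp g h)) s = map (act g) (map (act h) s).
  by rewrite -map_comp; apply: eq_map => p; apply: act_comp.
by rewrite E; case: Ug => ->; case: Uh => -> /=; rewrite ?map_rev ?revK.
Qed.

Lemma img_inv g s : unimodular g -> img (inv g) (img g s) = s.
Proof.
move=> Ug; have E : map (act (inv g)) (map (act g) s) = s.
  by rewrite -map_comp -[RHS]map_id; apply: eq_map => p; apply: act_inv.
by rewrite /img adet_inv //; case: Ug => -> /=; rewrite ?map_rev ?revK E.
Qed.

Lemma mem_img g s : img g s =i map (act g) s.
Proof. by move=> p; rewrite /img; case: ifP; rewrite ?mem_rev. Qed.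

Lemma size_img g s : size (img g s) = size s.
Proof. by rewrite /img; case: ifP; rewrite ?size_rev size_map. Qed.

Lemma det_act g p q r : det (act g p) (act g q) (act g r) = adet g * det p q r.
Proof. rewrite /det /adet /act /=; ring. Qed.

Lemma pairwise_rev (T : Type) (r : rel T) s :
  pairwise r (rev s) = pairwise (fun x y => r y x) s.
Proof.
elim: s => //= x s IHs; rewrite rev_cons pairwise_rcons IHs all_rev.
by congr (_ && _); apply: eq_all.
Qed.

Lemma ccw_img g s : unimodular g -> ccw (img g s) = ccw s.
Proof.
move=> Ug; rewrite /img; case: Ug => dg; rewrite dg /=.
  elim: s => //= a s ->; rewrite pairwise_map; congr (_ && _).
  by apply: eq_pairwise => b c; rewrite /= det_act dg Z.mul_1_l.
elim: s => //= a s IHs; rewrite rev_cons ccw_rcons IHs andbC pairwise_rev.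
rewrite pairwise_map; congr (_ && _).
apply: eq_pairwise => b c; rewrite /= det_act dg.
by congr (_ <? _); rewrite /det; ring.
Qed.

Lemma pentagon_img g s : unimodular g -> pentagon (img g s) = pentagon s.
Proof. by move=> Ug; rewrite /pentagon ccw_img // size_img. Qed.

Lemma joined_img g s t : unimodular g -> joined s t ->
  joined (img g s) (img g t).
Proof.
move=> Ug; elim=> [{}s {}t [Ps Pt [h Hh [sh th]]]|u|u v w _ uv _ vw].
- apply: rt_step; split; rewrite ?pentagon_img //.
  exists (img g h); first by rewrite ccw_img // size_img.
  by split=> p; rewrite !mem_img => /mapP[q qs ->]; apply: map_f; auto.
- exact: rt_refl.
- exact: rt_trans uv vw.
Qed.

(** Twice the Euclidean area, hence an integer that can be used for descent. *)
Fixpoint fan_area a (s : seq pt) : Z :=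
  if s is b :: ((c :: _) as t) then det a b c + fan_area a t else 0.
Definition area (s : seq pt) : Z := if s is a :: t then fan_area a t else 0.

Lemma pentagonP s : pentagon s ->
  exists a b c d e, s = [:: a; b; c; d; e] /\ ccw [:: a; b; c; d; e].
Proof.
case/andP; case: s => [|a [|b [|c [|d [|e []]]]]] //= H _.
by exists a, b, c, d, e.
Qed.

Lemma area_img g s : unimodular g -> pentagon s -> area (img g s) = area s.
Proof.
move=> Ug /pentagonP[a [b [c [d [e [-> _]]]]]].
by case: Ug => dg; rewrite /img dg /= /rev /= !det_act dg /det; ring.
Qed.

Lemma area_gt0 s : pentagon s -> 0 < area s.
Proof.
move=> /pentagonP[a [b [c [d [e [-> /ccw5P H]]]]]] /=; split_ands; lia.
Qed.

(** A pentagon of least area: the descent on the area ends at its images under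
    unimodular affine maps. *)
Definition base : seq pt := [:: (0, 0); (1, 0); (2, 1); (1, 2); (0, 1)].

Definition shrinkable s :=
  exists t, [/\ joined s t, pentagon t & area t < area s].
Definition reducible s :=
  shrinkable s \/ exists2 g, unimodular g & joined s (img g base).

Lemma reducible_joined s t : joined s t -> area s = area t ->
  reducible t -> reducible s.
Proof.
move=> st Est [[u [tu Pu ltu]]|[g Ug tg]].
  by left; exists u; split=> //; [apply: rt_trans tu | rewrite Est].
by right; exists g => //; apply: rt_trans tg.
Qed.

Lemma reducible_img g s : unimodular g -> pentagon s ->
  reducible (img g s) -> reducible s.
Proof.
move=> Ug Ps; have Ui := unimodular_inv Ug.
case=> [[t [st Pt ltt]]|[h Uh sh]].
  left; exists (img (inv g) t); split.
  - by rewrite -{1}(img_inv s Ug); apply: joined_img.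
  - by rewrite pentagon_img.
  - by rewrite area_img // -(area_img Ug Ps).
right; exists (comp (inv g) h); first exact: unimodular_comp.
by rewrite img_comp // -{1}(img_inv s Ug); apply: joined_img.
Qed.

Lemma reducible_rot a b c d e : ccw [:: a; b; c; d; e] ->
  reducible [:: b; c; d; e; a] -> reducible [:: a; b; c; d; e].
Proof.
move=> H; apply: reducible_joined; last by rewrite /= /det; ring.
apply: rt_step; apply: pentagon_linked => [||p]; rewrite ?/pentagon ?H //.
  by rewrite -(ccw_rot 1) /rot /= in H; rewrite andbT.
by rewrite !inE; do ![case/orP] => ->; rewrite ?orbT.
Qed.

(** Inserting [x] beyond the edge [a b] and deleting another vertex changes the
    area by the difference of the two ears that are cut off. *)
Lemma shrink_at_edge a b c d e x : ccw [:: a; b; c; d; e] ->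
  0 < det a x b -> 0 < det e a x -> 0 < det x b c ->
  (det a x b < det b c d \/ det a x b < det c d e \/ det a x b < det d e a \/
   det a x b < det e a x \/ det a x b < det x b c) ->
  reducible [:: a; b; c; d; e].
Proof.
move=> H axb eax xbc cases; have H6 := ccw_insert H axb eax xbc.
left; have {}cases : exists t, [/\ subseq t [:: a; x; b; c; d; e],
    size t == 5%N & area t < area [:: a; b; c; d; e]].
  case: cases => [|[|[|[|]]]] lt_ear.
  - exists [:: a; x; b; d; e]; split=> //; last by move: lt_ear; rewrite /= /det; lia.
    exact: (mask_subseq [:: true; true; true; false; true; true] [:: a; x; b; c; d; e]).
  - exists [:: a; x; b; c; e]; split=> //; last by move: lt_ear; rewrite /= /det; lia.
    exact: (mask_subseq [:: true; true; true; true; false; true] [:: a; x; b; c; d; e]).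
  - exists [:: a; x; b; c; d]; split=> //; last by move: lt_ear; rewrite /= /det; lia.
    exact: (mask_subseq [:: true; true; true; true; true; false] [:: a; x; b; c; d; e]).
  - exists [:: x; b; c; d; e]; split=> //; last by move: lt_ear; rewrite /= /det; lia.
    exact: (mask_subseq [:: false; true; true; true; true; true] [:: a; x; b; c; d; e]).
  - exists [:: a; x; c; d; e]; split=> //; last by move: lt_ear; rewrite /= /det; lia.
    exact: (mask_subseq [:: true; true; false; true; true; true] [:: a; x; b; c; d; e]).
case: cases => t [sub sz lt_t]; exists t.
have Pt : pentagon t by rewrite /pentagon sz andbT (subseq_ccw sub).
split=> //; apply: rt_step; split=> //; first by rewrite /pentagon H.
exists [:: a; x; b; c; d; e]; first by rewrite H6.
split; last exact: mem_subseq.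
by move=> p; rewrite !inE; do ![case/orP] => ->; rewrite ?orbT.
Qed.

(** * The unimodular images of the smallest pentagon *)

(** Two hexagons sharing five vertices share a pentagon, so that a walk through
    hexagons certifies [joined] by mere computation. *)
Definition adjacent_hexagons (h k : seq pt) :=
  [&& ccw k, size k == 6%N & size [seq x <- h | x \in k] == 5%N].

Definition hexagon_walk (s : seq pt) h hs (t : seq pt) :=
  [&& pentagon s, pentagon t, ccw h, size h == 6%N, all (mem h) s,
      all (mem (last h hs)) t & path adjacent_hexagons h hs].

Lemma hexagon_walk_joined s h hs t : hexagon_walk s h hs t -> joined s t.
Proof.
elim: hs h s => [|k hs IHhs] h s /and5P[Ps Pt Hh /eqP sz /and3P[/allP sh /allP th]].
  by move=> _; apply: rt_step; split=> //; exists h; rewrite ?Hh ?sz.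
case/andP=> /and3P[Hk szk szu] walk; set u := [seq x <- h | x \in k] in szu.
have Pu : pentagon u by rewrite /pentagon szu (subseq_ccw (filter_subseq _ _) Hh).
apply: rt_trans (IHhs k u _).
  apply: rt_step; split=> //; exists h; first by rewrite Hh sz.
  by split=> // p; rewrite mem_filter => /andP[].
apply/and5P; split=> //; apply/and3P; split=> //; last exact/allP.
by apply/allP => p; rewrite mem_filter => /andP[].
Qed.

Lemma joined_base_swap : joined base (img (Aff 0 1 1 0 0 0) base).
Proof. by apply: rt_step; apply: pentagon_linked => //; apply/allP. Qed.

Lemma joined_base_translation : joined base (img (Aff 1 0 0 1 1 0) base).
Proof.
by apply: (@hexagon_walk_joined _ [:: (0, 0); (1, 0); (2, 1); (2, 2); (1, 2); (0, 1)]
  [:: [:: (0, 0); (1, 0); (3, 1); (2, 2); (1, 2); (0, 1)];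
      [:: (0, 1); (0, 0); (1, 0); (3, 1); (3, 2); (2, 2)];
      [:: (1, 0); (2, 0); (3, 1); (3, 2); (2, 2); (0, 1)];
      [:: (1, 0); (2, 0); (3, 1); (3, 2); (2, 2); (1, 1)]]); vm_compute.
Qed.

Lemma joined_base_shear : joined base (img (Aff 1 1 0 1 0 0) base).
Proof.
by apply: (@hexagon_walk_joined _ [:: (0, 0); (1, 0); (2, 1); (3, 3); (1, 2); (0, 1)]
  [:: [:: (0, 0); (1, 0); (3, 2); (3, 3); (1, 2); (0, 1)];
      [:: (0, 0); (1, 0); (3, 1); (3, 2); (1, 2); (0, 1)];
      [:: (0, 0); (1, 0); (3, 1); (4, 2); (3, 2); (0, 1)];
      [:: (0, 0); (1, 0); (3, 1); (4, 2); (3, 2); (1, 1)]]); vm_compute.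
Qed.

Lemma joined_base_reflection : joined base (img (Aff (-1) 0 0 1 0 0) base).
Proof.
by apply: (@hexagon_walk_joined _ [:: (0, 0); (1, 0); (2, 1); (2, 2); (1, 2); (0, 1)]
  [:: [:: (0, 0); (1, 0); (2, 1); (2, 2); (1, 2); (-2, 1)];
      [:: (-2, 1); (-1, 0); (0, 0); (2, 1); (2, 2); (1, 2)];
      [:: (-2, 1); (-1, 0); (0, 0); (2, 1); (1, 2); (-2, 2)];
      [:: (-2, 1); (-1, 0); (0, 0); (2, 1); (-1, 2); (-2, 2)];
      [:: (-2, 1); (-1, 0); (0, 0); (0, 1); (-1, 2); (-2, 2)]]); vm_compute.
Qed.

(** Unimodular maps act on the components, so that the maps fixing the component
    of [base] form a group: it is enough to check generators. *)
Definition fixes_component g := unimodular g /\ joined base (img g base).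

Lemma fixes_comp g h : fixes_component g -> fixes_component h ->
  fixes_component (comp g h).
Proof.
move=> [Ug jg] [Uh jh]; split; first exact: unimodular_comp.
by rewrite img_comp //; apply: rt_trans jg _; apply: joined_img.
Qed.

Lemma fixes_inv g : fixes_component g -> fixes_component (inv g).
Proof.
move=> [Ug jg]; split; first exact: unimodular_inv.
rewrite -{1}(img_inv base Ug); apply: joined_sym.
exact: joined_img (unimodular_inv Ug) jg.
Qed.

Lemma fixes_shear k : fixes_component (Aff 1 k 0 1 0 0).
Proof.
have U : fixes_component (Aff 1 1 0 1 0 0).
  by split; [left | exact: joined_base_shear].
elim/Z.peano_ind: k => [|k IHk|k IHk].
- by split; [left | rewrite /img /=; exact: rt_refl].
- have -> : Aff 1 (Z.succ k) 0 1 0 0 = comp (Aff 1 1 0 1 0 0) (Aff 1 k 0 1 0 0).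
    by rewrite /comp /=; f_equal; lia.
  exact: fixes_comp.
- have -> : Aff 1 (Z.pred k) 0 1 0 0 =
            comp (inv (Aff 1 1 0 1 0 0)) (Aff 1 k 0 1 0 0).
    by rewrite /comp /inv /adet /=; f_equal; lia.
  by apply: fixes_comp => //; apply: fixes_inv.
Qed.

Lemma fixes_swap : fixes_component (Aff 0 1 1 0 0 0).
Proof. by split; [right | exact: joined_base_swap]. Qed.

Lemma fixes_translation k l : fixes_component (Aff 1 0 0 1 k l).
Proof.
have T1 : fixes_component (Aff 1 0 0 1 1 0).
  by split; [left | exact: joined_base_translation].
have Tk n : fixes_component (Aff 1 0 0 1 n 0).
  elim/Z.peano_ind: n => [|n IHn|n IHn].
  - by split; [left | rewrite /img /=; exact: rt_refl].
  - have -> : Aff 1 0 0 1 (Z.succ n) 0 = comp (Aff 1 0 0 1 1 0) (Aff 1 0 0 1 n 0).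
      by rewrite /comp /=; f_equal; lia.
    exact: fixes_comp.
  - have -> : Aff 1 0 0 1 (Z.pred n) 0 =
              comp (inv (Aff 1 0 0 1 1 0)) (Aff 1 0 0 1 n 0).
      by rewrite /comp /inv /adet /=; f_equal; lia.
    by apply: fixes_comp => //; apply: fixes_inv.
have -> : Aff 1 0 0 1 k l = comp (Aff 1 0 0 1 k 0)
    (comp (Aff 0 1 1 0 0 0) (comp (Aff 1 0 0 1 l 0) (Aff 0 1 1 0 0 0))).
  by rewrite /comp /=; f_equal; lia.
by do !apply: fixes_comp => //; apply: fixes_swap.
Qed.

Lemma fixes_sign a d : (a = 1 \/ a = -1) -> (d = 1 \/ d = -1) ->
  fixes_component (Aff a 0 0 d 0 0).
Proof.
have J : fixes_component (Aff (-1) 0 0 1 0 0).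
  by split; [right | exact: joined_base_reflection].
have K : fixes_component (Aff 1 0 0 (-1) 0 0).
  have -> : Aff 1 0 0 (-1) 0 0 = comp (Aff 0 1 1 0 0 0)
      (comp (Aff (-1) 0 0 1 0 0) (Aff 0 1 1 0 0 0)) by [].
  by do !apply: fixes_comp => //; apply: fixes_swap.
case=> -> [] -> //; first exact: (fixes_shear 0).
have -> : Aff (-1) 0 0 (-1) 0 0 = comp (Aff (-1) 0 0 1 0 0) (Aff 1 0 0 (-1) 0 0).
  by [].
exact: fixes_comp.
Qed.

(** Euclid's algorithm on the first column: shears, the swap and signs generate
    the linear part, to which translations are added. *)
Lemma fixes_unimodular g : unimodular g -> fixes_component g.
Proof.
have lin n : forall a b c d, (Z.to_nat (Z.abs c) < n)%coq_nat ->
    unimodular (Aff a b c d 0 0) -> fixes_component (Aff a b c d 0 0).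
  elim: n => [|n IHn] a b c d ltn Ug; first by lia.
  have [c0|c_neq0] := Z.eq_dec c 0.
    have ad : (a = 1 \/ a = -1) /\ (d = 1 \/ d = -1).
      move: Ug; rewrite /unimodular /adet /= c0 => Ug.
      have : a * d = 1 \/ a * d = -1 by lia.
      case=> E; first by split; [apply: (Z.eq_mul_1 _ d) | apply: (Z.eq_mul_1 _ a)]; lia.
      have : (- a = 1 \/ - a = -1) /\ (- d = 1 \/ - d = -1).
        by split; [apply: (Z.eq_mul_1 _ d) | apply: (Z.eq_mul_1 _ a)]; lia.
      by lia.
    have -> : Aff a b c d 0 0 = comp (Aff 1 (b * d) 0 1 0 0) (Aff a 0 0 d 0 0).
      rewrite /comp /= c0; f_equal; case: ad => _ []->; lia.
    by case: ad => aP dP; apply: fixes_comp; [apply: fixes_shear | apply: fixes_sign].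
  have -> : Aff a b c d 0 0 = comp (Aff 1 (a / c) 0 1 0 0)
      (comp (Aff 0 1 1 0 0 0) (Aff c d (a - a / c * c) (b - a / c * d) 0 0)).
    by rewrite /comp /=; f_equal; lia.
  apply: fixes_comp; first exact: fixes_shear.
  apply: fixes_comp; first exact: fixes_swap.
  apply: IHn.
    have -> : a - a / c * c = a mod c by rewrite Z.mod_eq //; lia.
    have [c_pos|c_neg] : 0 < c \/ c < 0 by lia.
      by have := Z.mod_pos_bound a c c_pos; lia.
    by have := Z.mod_neg_bound a c c_neg; lia.
  move: Ug; rewrite /unimodular /adet /=; nia.
case: g => a b c d e f Ug.
have -> : Aff a b c d e f = comp (Aff 1 0 0 1 e f) (Aff a b c d 0 0).
  by rewrite /comp /=; f_equal; lia.
apply: fixes_comp; first exact: fixes_translation.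
by apply: (lin (Z.to_nat (Z.abs c)).+1); first lia.
Qed.

Lemma pentagons_joined s t : (forall u, pentagon u -> reducible u) ->
  pentagon s -> pentagon t -> joined s t.
Proof.
move=> red; suff to_base u : pentagon u -> joined u base.
  by move=> /to_base sb /to_base/joined_sym; apply: rt_trans.
have [n] := ubnP (Z.to_nat (area u)); elim: n u => // n IHn u ltn Pu.
case: (red u Pu) => [[v [uv Pv ltv]]|[g Ug ug]].
  by apply: rt_trans uv (IHn v _ Pv); have := area_gt0 Pv; lia.
by apply: rt_trans ug _; apply: joined_sym; have [] := fixes_unimodular Ug.
Qed.

(** * An interior lattice point *)

Definition inside a b c d e m :=
  [/\ 0 < det a b m, 0 < det b c m, 0 < det c d m, 0 < det d e m & 0 < det e a m].

Lemma inside_rot a b c d e m : inside b c d e a m -> inside a b c d e m.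
Proof. by case. Qed.

Definition same_parity (p q : pt) :=
  exists m : pt, p.1 + q.1 = 2 * m.1 /\ p.2 + q.2 = 2 * m.2.

Definition parity (p : pt) := (Z.odd p.1, Z.odd p.2).

Lemma parity_same p q : parity p = parity q -> same_parity p q.
Proof.
case=> E1 E2.
exists (Z.div2 p.1 + Z.div2 q.1 + Z.b2z (Z.odd q.1),
        Z.div2 p.2 + Z.div2 q.2 + Z.b2z (Z.odd q.2)); split=> /=.
  by have := Z.div2_odd p.1; have := Z.div2_odd q.1; rewrite E1; lia.
by have := Z.div2_odd p.2; have := Z.div2_odd q.2; rewrite E2; lia.
Qed.

(** There are only four parity classes of lattice points. *)
Lemma five_parities (P : Prop) a b c d e :
  (same_parity a b -> P) -> (same_parity b c -> P) -> (same_parity c d -> P) ->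
  (same_parity d e -> P) -> (same_parity e a -> P) -> (same_parity a c -> P) ->
  (same_parity b d -> P) -> (same_parity c e -> P) -> (same_parity d a -> P) ->
  (same_parity e b -> P) -> P.
Proof.
move=> ab bc cd de ea ac bd ce da eb.
have: ~~ uniq [:: parity a; parity b; parity c; parity d; parity e].
  apply/negP => /card_uniqP cardE.
  have := max_card (mem [:: parity a; parity b; parity c; parity d; parity e]).
  by rewrite cardE card_prod card_bool.
move: (@parity_same a b) (@parity_same b c) (@parity_same c d) (@parity_same d e)
  (@parity_same e a) (@parity_same a c) (@parity_same b d) (@parity_same c e)
  (@parity_same d a) (@parity_same e b).
move: (parity a) (parity b) (parity c) (parity d) (parity e) => p q r s t.
move=> /(_ _)/ab{}ab /(_ _)/bc{}bc /(_ _)/cd{}cd /(_ _)/de{}de /(_ _)/ea{}ea.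
move=> /(_ _)/ac{}ac /(_ _)/bd{}bd /(_ _)/ce{}ce /(_ _)/da{}da /(_ _)/eb{}eb.
have [/ab//|/negbTE nab] := eqVneq p q.
have [/bc//|/negbTE nbc] := eqVneq q r.
have [/cd//|/negbTE ncd] := eqVneq r s.
have [/de//|/negbTE nde] := eqVneq s t.
have [/esym/ea//|/negbTE nea] := eqVneq p t.
have [/ac//|/negbTE nac] := eqVneq p r.
have [/bd//|/negbTE nbd] := eqVneq q s.
have [/ce//|/negbTE nce] := eqVneq r t.
have [/esym/da//|/negbTE nda] := eqVneq p s.
have [/esym/eb//|/negbTE neb] := eqVneq q t.
by rewrite /= !inE nab nbc ncd nde nea nac nbd nce nda neb.
Qed.

(** The new pentagon is the old one minus the triangle on [a], [m] and [e]. *)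
Lemma midpoint_edge a b c d e : ccw [:: a; b; c; d; e] -> same_parity a b ->
  exists m, ccw [:: m; b; c; d; e] /\ area [:: m; b; c; d; e] < area [:: a; b; c; d; e]
    /\ forall n, inside m b c d e n -> inside a b c d e n.
Proof.
move=> /ccw5P H [m [m1 m2]]; exists m; split_ands.
have b1 : b.1 = 2 * m.1 - a.1 by lia.
have b2 : b.2 = 2 * m.2 - a.2 by lia.
have eam : 0 < det e a m by have : 0 < det a b e by []; rewrite /det b1 b2; lia.
have Hm : ccw [:: m; b; c; d; e].
  have mid y z : 2 * det m y z = det a y z + det b y z.
    by rewrite /det b1 b2; ring.
  have bby y : det b b y = 0 by rewrite /det; ring.
  apply/ccw5P; have := mid b c; have := mid b d; have := mid b e.
  have := mid c d; have := mid c e; have := mid d e; rewrite !bby.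
  by repeat split => //; lia.
split=> //; split; first by move: eam; rewrite /= /det b1 b2; lia.
move=> n [mbn bcn cdn den emn]; split=> //.
  by move: mbn; rewrite /det b1 b2; lia.
case/ccw5P: Hm => *; split_ands.
by apply: (@fan_pos_left _ _ m n d); rotdet.
Qed.

Lemma midpoint_diagonal a b c d e : ccw [:: a; b; c; d; e] -> same_parity a c ->
  exists m, inside a b c d e m.
Proof.
move=> /ccw5P H [m [m1 m2]]; exists m; split_ands.
have mid y z : 2 * det y z m = det y z a + det y z c.
  have a1 : a.1 = 2 * m.1 - c.1 by lia.
  have a2 : a.2 = 2 * m.2 - c.2 by lia.
  by rewrite /det a1 a2; ring.
have yzy y z : det y z y = 0 by rewrite /det; ring.
have yzz y z : det y z z = 0 by rewrite /det; ring.
split.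
- by have := mid a b; rewrite yzy; lia.
- by have := mid b c; rewrite yzz -(detC a b c); lia.
- by have := mid c d; rewrite yzy -(detC a c d); lia.
- by have := mid d e; rewrite -(detC a d e) -(detC c d e); lia.
- by have := mid e a; rewrite yzz -(detC c e a) -(detC a c e); lia.
Qed.

Lemma ccw_rot1 a t : ccw (rcons t a) = ccw (a :: t).
Proof. by rewrite -rot1_cons ccw_rot. Qed.

Lemma ccw_rotl a b c d e : ccw [:: a; b; c; d; e] -> ccw [:: b; c; d; e; a].
Proof. by rewrite -(ccw_rot1 a [:: b; c; d; e]). Qed.

(** Two vertices have a lattice midpoint.  It is interior when they are not
    adjacent; otherwise the pentagon is replaced by a smaller one. *)
Lemma interior_point a b c d e : ccw [:: a; b; c; d; e] ->
  exists m, inside a b c d e m.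
Proof.
have [n] := ubnP (Z.to_nat (area [:: a; b; c; d; e])).
elim: n a b c d e => // n IHn a b c d e ltn H.
pose smaller a' b' c' d' e' := area [:: a'; b'; c'; d'; e'] = area [:: a; b; c; d; e].
have edge a' b' c' d' e' : smaller a' b' c' d' e' -> ccw [:: a'; b'; c'; d'; e'] ->
    same_parity a' b' -> exists m, inside a' b' c' d' e' m.
  move=> E H' /(midpoint_edge H')[m [Hm [ltm sub]]].
  have [|k] := IHn m b' c' d' e' _ Hm; last by exists k; apply: sub.
  have : 0 < area [:: m; b'; c'; d'; e'] by apply: area_gt0; rewrite /pentagon Hm.
  by move: E ltm; rewrite /smaller; lia.
have H1 := ccw_rotl H; have H2 := ccw_rotl H1.
have H3 := ccw_rotl H2; have H4 := ccw_rotl H3.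
have rotE (p q r s t : pt) : (exists m, inside q r s t p m) -> exists m, inside p q r s t m.
  by case=> m /inside_rot; exists m.
apply: (@five_parities _ a b c d e) => sp.
- exact: edge sp.
- by apply: (rotE a); apply: edge sp => //; rewrite /smaller /= /det; ring.
- by apply: (rotE a); apply: (rotE b); apply: edge sp => //; rewrite /smaller /= /det; ring.
- do 3 apply: (rotE).
  by apply: edge sp => //; rewrite /smaller /= /det; ring.
- do 4 apply: (rotE).
  by apply: edge sp => //; rewrite /smaller /= /det; ring.
- exact: midpoint_diagonal sp.
- by apply: rotE; apply: midpoint_diagonal sp.
- by do 2 apply: (rotE); apply: midpoint_diagonal sp.
- by do 3 apply: (rotE); apply: midpoint_diagonal sp.
- by do 4 apply: (rotE); apply: midpoint_diagonal sp.
Qed.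

(** * The edge facing an interior point *)

(** For an interior point [m], let [h_i = det m v_i v_(i+1)] and
    [d_i = det m v_(i-1) v_(i+1)].  The reflection [v_i + v_(i+1) - m] of [m] can be
    inserted beyond the edge [v_i v_(i+1)] if and only if [h_i] exceeds both [d_i]
    and [d_(i+1)].  If this failed at every edge, each [h_i] would be bounded by
    [d_i] or by [d_(i+1)]; as five is odd, the Plücker relations force the same
    choice at every edge, and then the [d_i] vary strictly in one direction
    all around the pentagon. *)

Lemma nonpos_of_product x y z w t u : 0 < x -> 0 < z -> 0 < u -> x <= y -> z <= w ->
  x * z = y * w + t * u -> t <= 0.
Proof. nia. Qed.

(** Bounding [h5] by [d1] and [h2] by [d2] makes [d4] nonpositive, which decides the
    choices at the third and fourth edges; whatever the choice at the first edge,
    the same step then makes the bound of [h3] or of [h4] nonpositive. *)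
Lemma no_alternation h1 h2 h3 h4 h5 d1 d2 d3 d4 d5 :
  0 < h1 -> 0 < h2 -> 0 < h3 -> 0 < h4 -> 0 < h5 ->
  h5 * h2 = d1 * d2 + d4 * h1 -> h1 * h3 = d2 * d3 + d5 * h2 ->
  h4 * h1 = d5 * d1 + d3 * h5 ->
  (h1 <= d1 \/ h1 <= d2) -> (h3 <= d3 \/ h3 <= d4) -> (h4 <= d4 \/ h4 <= d5) ->
  h5 <= d1 -> h2 <= d2 -> False.
Proof.
move=> h1p h2p h3p h4p h5p E1 E2 E5 c1 c3 c4 R5 L2.
have d4_le0 : d4 <= 0 by apply: nonpos_of_product E1.
have R4 : h4 <= d5 by lia.
have L3 : h3 <= d3 by lia.
case: c1 => [L1|R1].
  have : d3 <= 0 by apply: nonpos_of_product E5.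
  by lia.
have : d5 <= 0 by apply: nonpos_of_product E2.
by lia.
Qed.

Lemma facing_edge h1 h2 h3 h4 h5 d1 d2 d3 d4 d5 :
  0 < h1 -> 0 < h2 -> 0 < h3 -> 0 < h4 -> 0 < h5 ->
  h5 * h2 = d1 * d2 + d4 * h1 -> h1 * h3 = d2 * d3 + d5 * h2 ->
  h2 * h4 = d3 * d4 + d1 * h3 -> h3 * h5 = d4 * d5 + d2 * h4 ->
  h4 * h1 = d5 * d1 + d3 * h5 ->
  (d1 < h1 /\ d2 < h1) \/ (d2 < h2 /\ d3 < h2) \/ (d3 < h3 /\ d4 < h3) \/
  (d4 < h4 /\ d5 < h4) \/ (d5 < h5 /\ d1 < h5).
Proof.
move=> h1p h2p h3p h4p h5p E1 E2 E3 E4 E5.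
have [[? ?]|c1] : (d1 < h1 /\ d2 < h1) \/ (h1 <= d1 \/ h1 <= d2) by lia.
  by lia.
have [[? ?]|c2] : (d2 < h2 /\ d3 < h2) \/ (h2 <= d2 \/ h2 <= d3) by lia.
  by lia.
have [[? ?]|c3] : (d3 < h3 /\ d4 < h3) \/ (h3 <= d3 \/ h3 <= d4) by lia.
  by lia.
have [[? ?]|c4] : (d4 < h4 /\ d5 < h4) \/ (h4 <= d4 \/ h4 <= d5) by lia.
  by lia.
have [[? ?]|c5] : (d5 < h5 /\ d1 < h5) \/ (h5 <= d5 \/ h5 <= d1) by lia.
  by lia.
exfalso.
have A5 := no_alternation h1p h2p h3p h4p h5p E1 E2 E5 c1 c3 c4.
have A1 := no_alternation h2p h3p h4p h5p h1p E2 E3 E1 c2 c4 c5.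
have A2 := no_alternation h3p h4p h5p h1p h2p E3 E4 E2 c3 c5 c1.
have A3 := no_alternation h4p h5p h1p h2p h3p E4 E5 E3 c4 c1 c2.
have A4 := no_alternation h5p h1p h2p h3p h4p E5 E1 E4 c5 c2 c3.
case: c1 => [L1|R1].
  have L4 : h4 <= d4 by case: c4 => // /A4 /(_ L1).
  have L2 : h2 <= d2 by case: c2 => // /A2 /(_ L4).
  have L5 : h5 <= d5 by case: c5 => // /A5 /(_ L2).
  have L3 : h3 <= d3 by case: c3 => // /A3 /(_ L5).
  have : d5 > d1 by nia.
  have : d1 > d2 by nia.
  have : d2 > d3 by nia.
  have : d3 > d4 by nia.
  have : d4 > d5 by nia.
  by lia.
have R3 : h3 <= d4 by case: c3 => // /(A1 R1).
have R5 : h5 <= d1 by case: c5 => // /(A3 R3).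
have R2 : h2 <= d3 by case: c2 => // /(A5 R5).
have R4 : h4 <= d5 by case: c4 => // /(A2 R2).
have : d3 > d2 by nia.
have : d4 > d3 by nia.
have : d5 > d4 by nia.
have : d1 > d5 by nia.
have : d2 > d1 by nia.
by lia.
Qed.

(** * Decreasing the area *)

Lemma shrinkable_by_walk s h hs t :
  hexagon_walk s h hs t -> area t < area s -> reducible s.
Proof.
move=> walk lt_ts; left; exists t; split=> //; first exact: hexagon_walk_joined walk.
by case/and3P: walk.
Qed.

(** For the following four pentagons the area decreases after two exchanges, the
    first one through the far point [(1, -3)].  The fifth one is an image of
    [base].  The names record [area]. *)
Lemma reducible_area7 : reducible [:: (0, 0); (2, 0); (2, 2); (1, 2); (0, 1)].
Proof.
by apply: (@shrinkable_by_walk _ [:: (0, 0); (1, -3); (2, 0); (2, 2); (1, 2); (0, 1)]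
  [:: [:: (0, 0); (1, -3); (2, 1); (2, 2); (1, 2); (0, 1)]]
  [:: (0, 0); (2, 1); (2, 2); (1, 2); (0, 1)]).
Qed.

Lemma reducible_area6 : reducible [:: (0, 0); (2, 0); (2, 1); (1, 2); (0, 1)].
Proof.
by apply: (@shrinkable_by_walk _ [:: (0, 0); (1, -3); (2, 0); (2, 1); (1, 2); (0, 1)]
  [:: [:: (0, 1); (1, -3); (2, 0); (2, 1); (1, 2); (0, 2)]]
  [:: (0, 1); (2, 0); (2, 1); (1, 2); (0, 2)]).
Qed.

Lemma reducible_area10 : reducible [:: (0, 0); (4, 0); (3, 1); (1, 2); (0, 1)].
Proof.
by apply: (@shrinkable_by_walk _ [:: (0, 0); (1, -3); (4, 0); (3, 1); (1, 2); (0, 1)]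
  [:: [:: (0, 1); (1, -3); (4, 0); (3, 1); (1, 2); (0, 2)]]
  [:: (0, 1); (4, 0); (3, 1); (1, 2); (0, 2)]).
Qed.

Lemma reducible_area10_even : reducible [:: (0, 0); (2, 0); (2, 2); (1, 3); (0, 2)].
Proof.
by apply: (@shrinkable_by_walk _ [:: (0, 0); (1, -3); (2, 0); (2, 2); (1, 3); (0, 2)]
  [:: [:: (0, 2); (0, 1); (1, -3); (2, 0); (2, 2); (1, 3)]]
  [:: (0, 1); (2, 0); (2, 2); (1, 3); (0, 2)]).
Qed.

Lemma reducible_area5 : reducible [:: (0, 0); (1, 0); (2, 2); (2, 3); (1, 2)].
Proof.
right; exists (Aff (-1) 0 (-1) (-1) 2 3); first by left.
by apply: rt_step; apply: pentagon_linked => //; apply/allP.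
Qed.

(** In the next three lemmas a pentagon stands with its first edge on the
    horizontal axis, and the name lists the heights of its other vertices.  Here
    the fourth vertex has a neighbor [(c + 1, 3)] on its row, beyond the edge to
    the third one; a shear has first reduced [b] to [0] or [1]. *)
Lemma reducible_heights_2_3_2 l a c b :
  ccw [:: (0, 0); (l, 0); (a, 2); (c, 3); (b, 2)] -> a = b + l -> 2 * c = 3 * b + l ->
  reducible [:: (0, 0); (l, 0); (a, 2); (c, 3); (b, 2)].
Proof.
move=> H Ea Ec.
pose k := Z.div2 b; have bE := Z.div2_odd b.
pose g := Aff 1 (- k) 0 1 0 0.
have dg : adet g = 1 by rewrite /adet /=; lia.
have Ug : unimodular g by left.
have Ps : pentagon [:: (0, 0); (l, 0); (a, 2); (c, 3); (b, 2)] by rewrite /pentagon H.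
apply: (reducible_img Ug Ps).
have l_gt0 : 0 < l by case/ccw5P: H; rewrite /det /= => *; lia.
have := Ps; rewrite -(pentagon_img _ Ug) => /andP[+ _].
have -> : img g [:: (0, 0); (l, 0); (a, 2); (c, 3); (b, 2)] =
   [:: (0, 0); (l, 0); (a - 2 * k, 2); (c - 3 * k, 3); (b - 2 * k, 2)].
  by rewrite /img dg /act /=; congr [:: (_, _); (_, _); (_, _); (_, _); (_, _)]; lia.
move: bE; rewrite -/k; case: (Z.odd b) => /= bE.
  have [l1|l3] : l = 1 \/ 3 <= l by lia.
    by move=> _; have := reducible_area5;
      congr (reducible [:: (_, _); (_, _); (_, _); (_, _); (_, _)]); lia.
  move=> H'; do 2 (apply: reducible_rot => //; move/ccw_rotl: H' => H').
  by apply: (@shrink_at_edge _ _ _ _ _ (c - 3 * k + 1, 3)) => //; rewrite /det /=; nia.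
have [l1|l3] : l = 2 \/ 3 <= l by lia.
  by move=> _; have := reducible_area10_even;
      congr (reducible [:: (_, _); (_, _); (_, _); (_, _); (_, _)]); lia.
move=> H'; do 2 (apply: reducible_rot => //; move/ccw_rotl: H' => H').
by apply: (@shrink_at_edge _ _ _ _ _ (c - 3 * k + 1, 3)) => //; rewrite /det /=; nia.
Qed.

(** The third and fourth vertices are on the same row, so a point of the first row
    can be inserted to the right of the edge between the second and third ones.
    Its ear is at most [p], to be compared with the ear [l] of the first vertex.
    Only one pentagon for each [p] does not shrink in this way. *)
Lemma reducible_heights_p_p_1 l a p c :
  ccw [:: (0, 0); (l, 0); (a, p); (c, p); (0, 1)] -> c <= l -> (a - c) * p <= l ->
  reducible [:: (0, 0); (l, 0); (a, p); (c, p); (0, 1)].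
Proof.
move=> H cl acl; have /ccw5P := H; rewrite /det /= => D.
have [l_gt0 [p_gt0 [c_gt0 ac]]] : 0 < l /\ 0 < p /\ 0 < c /\ 0 < (a - c) * (p - 1).
  by split_ands; split; [|split; [|split]]; nia.
clear D.
have p2 : 2 <= p by nia.
have {}ac : c < a by nia.
(* [(x, 1)] is the first lattice point of its row beyond the right edge *)
pose x := l + (a - l) / p + 1.
have [lo hi] : 0 < p * (x - l) - (a - l) <= p.
  have := Z.div_mod (a - l) p; have := Z.mod_pos_bound (a - l) p; rewrite /x; nia.
have [lt_l|ge_l] : p * (x - l) - (a - l) < l \/ l <= p * (x - l) - (a - l) by lia.
  apply: reducible_rot => //; move/ccw_rotl: H => H.
  by apply: (@shrink_at_edge _ _ _ _ _ (x, 1)) => //; rewrite /det /=; nia.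
have a_eq : a = c + 1 by nia.
have l_eq : l = p by nia.
have E : a = p * (x - l) by nia.
have x_eq : x - l = 1 by nia.
rewrite {}x_eq in E.
have {a_eq} c_eq : c = p - 1 by nia.
have a_eq : a = p by lia.
subst l c a.
have [p_eq2|p3] : p = 2 \/ 3 <= p by lia.
  by subst p; apply: reducible_area7.
by apply: (@shrink_at_edge _ _ _ _ _ (1, -1)) => //; rewrite /det /=; nia.
Qed.

(** If [c >= 2] the first lattice point above the edge between the fourth and fifth
    vertices on the column [x = 1] has an ear of at most [c], less than the ear [l]
    of the first vertex.  If [c = 1] this column contains the fourth vertex, and
    one inserts [(1, -1)] or [(2, 2)] instead, apart from two pentagons. *)
Lemma reducible_heights_p_Sp_1 l a p c :
  ccw [:: (0, 0); (l, 0); (a, p); (c, p + 1); (0, 1)] ->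
  a * p - c * (p - 1) <= l ->
  reducible [:: (0, 0); (l, 0); (a, p); (c, p + 1); (0, 1)].
Proof.
move=> H T4; have /ccw5P := H; rewrite /det /= => D.
have [l_gt0 [p_gt0 [c_gt0 T3]]] :
    0 < l /\ 0 < p /\ 0 < c /\ 0 < a * (p + 1) - p * c - l.
  by split_ands; split; [|split; [|split]]; nia.
clear D.
have ac : c < a by nia.
have cl : c < l by nia.
have [c1|c2] : c = 1 \/ 2 <= c by lia.
  subst c; have [p1|p2] : p = 1 \/ 2 <= p by lia.
    subst p; have [l1|[l2|l3]] : l = a \/ l = a + 1 \/ a + 2 <= l by lia.
    - subst l; have [a2|a3] : a = 2 \/ 3 <= a by lia.
        by subst a; apply: reducible_area6.
      do 2 (apply: reducible_rot => //; move/ccw_rotl: H => H).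
      by apply: (@shrink_at_edge _ _ _ _ _ (2, 2)) => //; rewrite /det /=; nia.
    - subst l; have [a3|a4] : a = 3 \/ 4 <= a by lia.
        by subst a; apply: reducible_area10.
      do 2 (apply: reducible_rot => //; move/ccw_rotl: H => H).
      by apply: (@shrink_at_edge _ _ _ _ _ (2, 2)) => //; rewrite /det /=; nia.
    - by apply: (@shrink_at_edge _ _ _ _ _ (1, -1)) => //; rewrite /det /=; nia.
  by apply: (@shrink_at_edge _ _ _ _ _ (1, -1)) => //; rewrite /det /=; nia.
pose y := 2 + p / c.
have [lo hi] : 0 < c * (y - 1) - p <= c.
  by have := Z.div_mod p c; have := Z.mod_pos_bound p c; rewrite /y; nia.
have yp : y <= p + 1 by nia.
have v3v4x : 0 < (a - c) * (p + 1 - y) + (c - 1) by nia.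
do 3 (apply: reducible_rot => //; move/ccw_rotl: H => H).
by apply: (@shrink_at_edge _ _ _ _ _ (1, y)) => //; rewrite /det /=; lia.
Qed.

(** The point [(nu, -1)] has an ear of area [l] on the first edge.  Suppose that no
    other ear of the hexagon is larger.  The quadratic relation between the five
    ears of a pentagon, which are here [l r], [l p], [T3], [T4] and [T5], is [key]
    and gives [(q - p) (q - r) <= q].  On the other hand, the ears of the hexagon at
    the two ends of the first edge bound from below the triangle of the first, third
    and fifth vertices, and this gives [p r - 1 <= q].  Few heights satisfy both. *)
Lemma stuck_shape l a p c q b r nu T3 T4 T5 :
  0 < l -> 0 < r -> r <= p ->
  T3 = (a - l) * q - p * (c - l) -> T4 = (c - a) * (r - p) - (q - p) * (b - a) ->
  T5 = c * r - q * b ->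
  0 < T3 <= l -> 0 < T4 <= l -> 0 < T5 <= l ->
  0 < a * q - p * c -> 0 < b + r * nu <= l -> 0 < p * (l - nu) - (a - l) <= l ->
  (r = 1 /\ (q = p \/ q = p + 1)) \/
  (r = 2 /\ p = 2 /\ q = 3 /\ T4 = l /\ T5 = l).
Proof.
move=> l_gt0 r_gt0 rp E3 E4 E5 B3 B4 B5 F B1 B2.
have F' : 0 < l * q + T3 - l * p by lia.
have qp : p <= q by nia.
have low : p * r * l - p * l <= a * r - b * p by nia.
have area2 : l * q + T3 + T5 = l * p + T4 + (a * r - b * p) by rewrite E3 E4 E5; ring.
have qpr : p * r - 1 <= q by nia.
have key : l * ((q - p) * (q - r)) + T3 * (q - r) + T5 * (q - p) = T4 * q.
  by rewrite E3 E4 E5; ring.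
have uw : (q - p) * (q - r) <= q by nia.
have [r1|r2] : r = 1 \/ 2 <= r by lia.
  by left; split=> //; nia.
have [p2|p3] : p = 2 \/ 3 <= p by lia.
  have {r2} r2 : r = 2 by lia.
  subst p r; right; have [q3|[q4|q5]] : q = 3 \/ q = 4 \/ 5 <= q by lia.
  - by subst q; lia.
  - by subst q; lia.
  - by exfalso; clear - uw q5; nia.
exfalso; clear - r2 p3 rp qpr uw.
have u2 : p - 1 <= q - p by nia.
have : q - r <= 2 by nia.
by nia.
Qed.

Lemma reducible_normal_le l a p c q b r nu :
  ccw [:: (0, 0); (l, 0); (a, p); (c, q); (b, r)] -> 0 < l -> r <= p ->
  0 < b + r * nu -> 0 < p * (l - nu) - (a - l) ->
  reducible [:: (0, 0); (l, 0); (a, p); (c, q); (b, r)].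
Proof.
move=> H l_gt0 rp B1 B2; have /ccw5P D := H; rewrite /det /= in D; split_ands.
have r_gt0 : 0 < r by apply: (proj1 (Z.mul_pos_cancel_l l r l_gt0)); lia.
pose T3 := (a - l) * q - p * (c - l).
pose T4 := (c - a) * (r - p) - (q - p) * (b - a).
pose T5 := c * r - q * b.
have T3p : 0 < T3 by rewrite /T3; lia.
have T4p : 0 < T4 by rewrite /T4; lia.
have T5p : 0 < T5 by rewrite /T5; lia.
have Fp : 0 < a * q - p * c by lia.
have [ear|[ear1 [ear2 [ear3 [ear4 ear5]]]]] :
   (l < T3 \/ l < T4 \/ l < T5 \/ l < b + r * nu \/ l < p * (l - nu) - (a - l)) \/
   (T3 <= l /\ T4 <= l /\ T5 <= l /\ b + r * nu <= l /\ p * (l - nu) - (a - l) <= l).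
  by lia.
  by apply: (@shrink_at_edge _ _ _ _ _ (nu, -1)) => //; rewrite /det /=; lia.
have [[r1 qE]|[r2 [p2 [q3 [T4l T5l]]]]] := @stuck_shape l a p c q b r nu T3 T4 T5
  l_gt0 r_gt0 rp erefl erefl erefl (conj T3p ear1) (conj T4p ear2) (conj T5p ear3)
  Fp (conj B1 ear4) (conj B2 ear5); last first.
  by subst r p q; apply: reducible_heights_2_3_2 => //; move: T4l T5l; rewrite /T4 /T5; lia.
pose g := Aff 1 (- b) 0 1 0 0.
have dg : adet g = 1 by rewrite /adet /=; lia.
have Ug : unimodular g by left.
have Ps : pentagon [:: (0, 0); (l, 0); (a, p); (c, q); (b, r)] by rewrite /pentagon H.
apply: (reducible_img Ug Ps).
have := Ps; rewrite -(pentagon_img _ Ug) => /andP[+ _].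
have -> : img g [:: (0, 0); (l, 0); (a, p); (c, q); (b, r)] =
    [:: (0, 0); (l, 0); (a - b * p, p); (c - b * q, q); (0, 1)].
  rewrite /img dg /act r1 /=.
  by congr [:: (_, _); (_, _); (_, _); (_, _); (_, _)]; lia.
move: ear1 ear2 ear3; rewrite /T3 /T4 /T5 r1.
case: qE => -> *; first by apply: reducible_heights_p_p_1 => //; lia.
by apply: reducible_heights_p_Sp_1 => //; lia.
Qed.

(** The reflection exchanging the two ends of the first edge exchanges [p] and
    [r]. *)
Lemma reducible_normal l a p c q b r nu :
  ccw [:: (0, 0); (l, 0); (a, p); (c, q); (b, r)] -> 0 < l ->
  0 < b + r * nu -> 0 < p * (l - nu) - (a - l) ->
  reducible [:: (0, 0); (l, 0); (a, p); (c, q); (b, r)].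
Proof.
move=> H l_gt0 B1 B2; have [rp|pr] : r <= p \/ p <= r by lia.
  exact: reducible_normal_le B1 B2.
pose g := Aff (-1) 0 0 1 l 0.
have Ug : unimodular g by right.
have Ps : pentagon [:: (0, 0); (l, 0); (a, p); (c, q); (b, r)] by rewrite /pentagon H.
apply: (reducible_img Ug Ps).
have := Ps; rewrite -(pentagon_img _ Ug) => /andP[+ _].
have -> : img g [:: (0, 0); (l, 0); (a, p); (c, q); (b, r)] =
    [:: (l - b, r); (l - c, q); (l - a, p); (0, 0); (l, 0)].
  rewrite /img /act /= /rev /=.
  by congr [:: (_, _); (_, _); (_, _); (_, _); (_, _)]; lia.
move=> H'; do 3 (apply: reducible_rot => //; move/ccw_rotl: H' => H').
by apply: (@reducible_normal_le _ _ _ _ _ _ _ (l - nu)) => //; lia.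
Qed.

(** The triangle spanned by the first edge and a lattice point [(mu, k)] facing it
    contains a lattice point at height one, namely the first one on or to the right
    of the segment from the origin to [(mu, k)].  It faces the edge too, and its
    reflection in the midpoint of the edge has height [-1]. *)
Lemma reducible_above l a p c q b r mu k :
  ccw [:: (0, 0); (l, 0); (a, p); (c, q); (b, r)] -> 0 < l ->
  0 < l * k -> 0 < r * (l - mu) + b * k -> 0 < p * mu - (a - l) * k ->
  reducible [:: (0, 0); (l, 0); (a, p); (c, q); (b, r)].
Proof.
move=> H l_gt0 /(proj1 (Z.mul_pos_cancel_l l k l_gt0)) k_gt0 E5 E2.
have [p_gt0 r_gt0] : 0 < p /\ 0 < r.
  case/ccw5P: H; rewrite /det /= => Hp [_ [Hr _]].
  by split; apply: (proj1 (Z.mul_pos_cancel_l l _ l_gt0)); lia.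
(* the least integer that is at least [mu / k] *)
pose m := - (- mu / k).
have [lo hi] : mu <= k * m <= mu + k - 1.
  have := Z.div_mod (- mu) k; have := Z.mod_pos_bound (- mu) k k_gt0.
  by rewrite /m; lia.
apply: (@reducible_normal _ _ _ _ _ _ _ (l - m)) => //;
  apply: (proj1 (Z.mul_pos_cancel_l k _ k_gt0)).
  have : r * (k * m) <= r * (mu + k - 1) by apply: Z.mul_le_mono_nonneg_l; lia.
  have : 0 <= r * ((l - 1) * (k - 1)) by do !apply: Z.mul_nonneg_nonneg; lia.
  by move: E5; clear; lia.
have : p * mu <= p * (k * m) by apply: Z.mul_le_mono_nonneg_l; lia.
by move: E2; clear; lia.
Qed.

(** Bézout coefficients straighten the edge onto the horizontal axis. *)
Lemma unimodular_edge a b : a <> b ->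
  exists g l, [/\ adet g = 1, act g a = (0, 0), act g b = (l, 0) & 0 < l].
Proof.
move=> ab; set u := b.1 - a.1; set v := b.2 - a.2.
have uv : u <> 0 \/ v <> 0.
  case: (Z.eq_dec u 0) => [u0|]; last by left.
  right=> v0; apply: ab; case: a b @u @v u0 v0 => a1 a2 [b1 b2] /= u0 v0.
  by congr (_, _); lia.
have gp : 0 < Z.gcd u v.
  by have := Z.gcd_nonneg u v; have := Z.gcd_eq_0 u v; lia.
have [s [t bez]] : Z.Bezout u v (Z.gcd u v) by apply: Z.gcd_bezout.
have [u' uE] := Z.gcd_divide_l u v; have [v' vE] := Z.gcd_divide_r u v.
have st : s * u' + t * v' = 1 by nia.
exists (Aff s t (- v') u' (- (s * a.1 + t * a.2)) (v' * a.1 - u' * a.2)).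
exists (Z.gcd u v); split=> //.
- by rewrite /adet /=; lia.
- by rewrite /act /=; congr (_, _); lia.
rewrite /act /=; congr (_, _).
  by rewrite -[RHS]bez /u /v; ring.
have -> : b.1 = a.1 + u' * Z.gcd u v by rewrite -uE /u; ring.
have -> : b.2 = a.2 + v' * Z.gcd u v by rewrite -vE /v; ring.
ring.
Qed.

Lemma reducible_facing a b c d e m : ccw [:: a; b; c; d; e] ->
  0 < det a b m -> det m e b < det m a b -> det m a c < det m a b ->
  reducible [:: a; b; c; d; e].
Proof.
move=> H abm ea ac; have abNe : a <> b.
  by move=> ab; move/ccw5P: H; rewrite ab /det => -[]; lia.
have [g [l [dg ga gb l_gt0]]] := unimodular_edge abNe.
have Ug : unimodular g by left.
have Ps : pentagon [:: a; b; c; d; e] by rewrite /pentagon H.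
apply: (reducible_img Ug Ps).
have gdet x y z : det (act g x) (act g y) (act g z) = det x y z.
  by rewrite det_act dg; lia.
rewrite -(gdet a b m) in abm; rewrite -!(gdet m) in ea ac.
have := Ps; rewrite -(pentagon_img _ Ug) => /andP[+ _].
rewrite /img dg /= ga gb in abm ea ac *.
case: (act g m) abm ea ac => mu k; case: (act g c) => a' p; case: (act g d) => c' q.
case: (act g e) => b' r; rewrite /det /= => abm ea ac H'.
by apply: (@reducible_above _ _ _ _ _ _ _ mu k) => //; move: abm ea ac; clear; lia.
Qed.

Lemma pentagon_reducible s : pentagon s -> reducible s.
Proof.
case/pentagonP=> a [b [c [d [e [-> H]]]]].
have [m [abm bcm cdm dem eam]] := interior_point H.
have := @facing_edge (det m a b) (det m b c) (det m c d) (det m d e) (det m e a)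
  (det m e b) (det m a c) (det m b d) (det m c e) (det m d a).
have H2 := ccw_rotl H; have H3 := ccw_rotl H2.
have H4 := ccw_rotl H3; have H5 := ccw_rotl H4.
case=> [||||||||||[? ?]|[[? ?]|[[? ?]|[[? ?]|[? ?]]]]].
1-5: rotdet.
1-5: rewrite /det; ring.
- exact: (@reducible_facing _ _ _ _ _ m).
- by apply: reducible_rot => //; apply: (@reducible_facing _ _ _ _ _ m).
- by do 2 apply: reducible_rot => //; apply: (@reducible_facing _ _ _ _ _ m).
- by do 3 apply: reducible_rot => //; apply: (@reducible_facing _ _ _ _ _ m).
- by do 4 apply: reducible_rot => //; apply: (@reducible_facing _ _ _ _ _ m).
Qed.

Lemma pentagons_connected s t : pentagon s -> pentagon t -> joined s t.
Proof. by apply: pentagons_joined; apply: pentagon_reducible. Qed.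

(** * Counterclockwise enumeration of a convexly independent set *)

(** No point is in a segment or triangle of others; integral weights suffice to
    express this for lattice points. *)
Definition convexly_independent (s : seq pt) :=
  forall p q r m : pt, p \in s -> q \in s -> r \in s -> m \in s ->
  forall a b c, 0 <= a -> 0 <= b -> 0 <= c -> 0 < a + b + c ->
  (a + b + c) * m.1 = a * p.1 + b * q.1 + c * r.1 ->
  (a + b + c) * m.2 = a * p.2 + b * q.2 + c * r.2 ->
  m \in [:: p; q; r].

Definition lexlt (p q : pt) := p.1 < q.1 \/ (p.1 = q.1 /\ p.2 < q.2).

Lemma lexlt_total p q : p <> q -> lexlt p q \/ lexlt q p.
Proof.
case: p q => [x y] [x' y'] pq; rewrite /lexlt /=.
have [x_eq|] := Z.eq_dec x x'; last by lia.
have [y_eq|] := Z.eq_dec y y'; last by lia.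
by case: pq; rewrite x_eq y_eq.
Qed.

Lemma lexmin (a : pt) s : exists2 o, o \in a :: s &
  forall p, p \in a :: s -> p <> o -> lexlt o p.
Proof.
elim: s a => [|b s IHs] a.
  by exists a; rewrite ?mem_head // => p; rewrite inE => /eqP.
have [o os min] := IHs b; have [->|/eqP ao] := eqVneq a o.
  by exists o; rewrite ?mem_head // => p; rewrite inE => /orP[/eqP|/min].
have [ltao|ltoa] := lexlt_total ao.
  exists a; first exact: mem_head.
  move=> p; rewrite inE => /orP[/eqP //|ps] _.
  have [->//|/eqP po] := eqVneq p o.
  by have := min p ps po; move: ltao; rewrite /lexlt; lia.
exists o; first by rewrite inE os orbT.
by move=> p; rewrite inE => /orP[/eqP->//|/min].
Qed.

Lemma det_trans o p q r : lexlt o p -> lexlt o q -> lexlt o r ->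
  0 <= det o p q -> 0 <= det o q r -> 0 <= det o p r.
Proof.
case: o p q r => [ox oy] [px py] [qx qy] [rx ry]; rewrite /lexlt /det /=.
have [qo|qo] : qx = ox \/ qx <> ox by lia.
  by subst qx => *; nia.
move=> op oq or pq qr.
have E : (qx - ox) * ((px - ox) * (ry - oy) - (py - oy) * (rx - ox)) =
  (px - ox) * ((qx - ox) * (ry - oy) - (qy - oy) * (rx - ox)) +
  (rx - ox) * ((px - ox) * (qy - oy) - (py - oy) * (qx - ox)) by ring.
have : 0 <= (qx - ox) * ((px - ox) * (ry - oy) - (py - oy) * (rx - ox)).
  by rewrite E; apply: Z.add_nonneg_nonneg; apply: Z.mul_nonneg_nonneg; lia.
nia.
Qed.

Lemma collinear_dependent (s : seq pt) (o p q : pt) : convexly_independent s ->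
  p \in s -> q \in s -> o \in s -> lexlt o p -> lexlt o q -> det o p q = 0 -> p = q.
Proof.
move=> ind ps qs os op oq opq.
have p_o : p <> o by move=> E; move: op; rewrite E /lexlt; lia.
have q_o : q <> o by move=> E; move: oq; rewrite E /lexlt; lia.
(* the ratio [a / b] places [u] on the segment from [o] to [w]; below it is read
   off on a coordinate along which the points differ *)
have between (u w : pt) (a b : Z) : u \in s -> w \in s -> u <> o -> 0 <= a <= b -> 0 < b ->
    b * (u.1 - o.1) = a * (w.1 - o.1) -> b * (u.2 - o.2) = a * (w.2 - o.2) -> u = w.
  move=> us ws uo ab b_gt0 E1 E2.
  have := @ind w o o u ws os os us a (b - a) 0.
  move/(_ ltac:(lia) ltac:(lia) ltac:(lia) ltac:(lia) ltac:(lia) ltac:(lia)).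
  by rewrite !inE => /or3P[] /eqP.
set px := p.1 - o.1 in between *; set py := p.2 - o.2 in between *.
set qx := q.1 - o.1 in between *; set qy := q.2 - o.2 in between *.
have {}op : 0 < px \/ px = 0 /\ 0 < py by rewrite /px /py; move: op; rewrite /lexlt; lia.
have {}oq : 0 < qx \/ qx = 0 /\ 0 < qy by rewrite /qx /qy; move: oq; rewrite /lexlt; lia.
have {}opq : px * qy = py * qx by move: opq; rewrite /det -/px -/py -/qx -/qy; lia.
have Bp a b : 0 <= a <= b -> 0 < b -> b * px = a * qx -> b * py = a * qy -> p = q.
  exact: between.
have Bq a b : 0 <= a <= b -> 0 < b -> b * qx = a * px -> b * qy = a * py -> p = q.
  by move=> *; apply/esym; apply: (between q p a b).
move: op oq opq Bp Bq; clearbody px py qx qy; clear => op oq opq Bp Bq.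
have [p1|p1] : 0 < px \/ px = 0 by lia.
  have q1 : 0 < qx by nia.
  have [le_pq|le_qp] : px <= qx \/ qx <= px by lia.
    by apply: (Bp px qx); lia.
  by apply: (Bq qx px); lia.
have q1 : qx = 0 by nia.
have [le_pq|le_qp] : py <= qy \/ qy <= py by lia.
  by apply: (Bp py qy); lia.
by apply: (Bq qy py); lia.
Qed.

(** Seen from the lexicographically least point all others lie in a half-plane,
    where the angular order is total.  Independence excludes collinear triples
    and points inside the triangles of the resulting fan. *)
Lemma ccw_enumeration (s : seq pt) : uniq s -> convexly_independent s ->
  exists2 t, perm_eq t s & ccw t.
Proof.
case: s => [|a s0]; first by exists [::].
have [o os min] := lexmin a s0; set s := a :: s0 in os min * => Us ind.
have [i s1 rot_s] := rot_to os.
have Us1 : uniq (o :: s1) by rewrite -rot_s rot_uniq.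
have mem1 p : (p \in o :: s1) = (p \in s) by rewrite -rot_s mem_rot.
have lt_o p : p \in s1 -> lexlt o p.
  move=> ps; apply: min; first by rewrite -mem1 inE ps orbT.
  by move=> po; move: Us1; rewrite /= -po ps.
pose leT p q := 0 <=? det o p q.
have totT : {in s1 &, total leT}.
  by move=> p q _ _; rewrite /leT /det; lia.
have trT : {in s1 & &, transitive leT}.
  move=> q p r qs ps rs; rewrite /leT => /Z.leb_le pq /Z.leb_le qr; apply/Z.leb_le.
  by apply: det_trans pq qr; apply: lt_o.
pose t := sort leT s1.
have mem_t p : (p \in t) = (p \in s1) by rewrite mem_sort.
have Ut : uniq t by rewrite sort_uniq; case/andP: Us1.
have pw : pairwise leT t.
  have all_s1 : all (mem s1) t by apply/allP => p; rewrite mem_t.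
  by rewrite -(sorted_pairwise_in trT all_s1); apply: (sort_sorted_in totT); apply/allP.
exists (o :: t).
  rewrite perm_sym -(perm_rot i s) rot_s perm_cons perm_sym.
  exact/permPl/perm_sort.
have os1 p : p \in s1 -> p <> o.
  by move=> ps po; move: Us1; rewrite /= -po ps.
have in_s p : p \in s1 -> p \in s by rewrite -mem1 inE => ->; rewrite orbT.
have strict : {in s1 &, forall p q, leT p q && (p != q) -> 0 <? det o p q}.
  move=> p q ps qs /andP[/Z.leb_le pq /eqP p_neq_q]; apply/Z.ltb_lt.
  have [] : 0 < det o p q \/ det o p q = 0 by lia.
    by [].
  by move/(collinear_dependent ind (in_s _ ps) (in_s _ qs) os (lt_o _ ps) (lt_o _ qs)).
have {strict}pw : pairwise (fun p q => 0 <? det o p q) t.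
  apply: (sub_in_pairwise strict); first by apply/allP => p; rewrite mem_t.
  by rewrite pairwise_relI pw -uniq_pairwise.
rewrite /= pw /=.
have sub_t : {subset t <= s} by move=> p; rewrite mem_t; apply: in_s.
elim: (t) sub_t pw => //= p u IHu sub_u /andP[pu pwu].
rewrite IHu ?andbT => // [|q qu]; last by apply: sub_u; rewrite inE qu orbT.
pose P := [pred q | (q \in u) && (0 <? det o p q)].
have all_P : all P u.
  by apply/allP => q qu; rewrite /= qu; apply: (allP pu).
apply: sub_in_pairwise all_P pwu => q r /andP[qu /Z.ltb_lt pq] /andP[ru /Z.ltb_lt pr].
move=> /Z.ltb_lt qr; apply/Z.ltb_lt.
have [//|pqr] : 0 < det p q r \/ det p q r <= 0 by lia.
have := @ind p r o q (sub_u _ (mem_head _ _)) (sub_u _ (mem_behead (s := p :: u) ru))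
  os (sub_u _ (mem_behead (s := p :: u) qu)) (det o q r) (det o p q) (- det p q r).
have sumE : det o q r + det o p q + - det p q r = det o p r by rewrite /det; ring.
have pqr0 : 0 <= - det p q r by move: pqr; clear; lia.
rewrite sumE => /(_ (Z.lt_le_incl _ _ qr) (Z.lt_le_incl _ _ pq) pqr0 pr).
move/(_ ltac:(rewrite /det; ring) ltac:(rewrite /det; ring)).
rewrite !inE => /or3P[] /eqP E; exfalso.
- by move: pq; rewrite E /det; clear; lia.
- by move: qr; rewrite E /det; clear; lia.
- by move: pq; rewrite E /det; clear; lia.
Qed.

Lemma ccw_uniq (s : seq pt) : (2 < size s)%N -> ccw s -> uniq s.
Proof.
case: s => [|a [|b [|c s]]] // _ /andP[pw _].
have irr : irreflexive (fun x y => 0 <? det a x y).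
  by move=> x; apply/Z.ltb_ge; rewrite /det; lia.
rewrite cons_uniq (pairwise_uniq irr pw) andbT inE; apply/norP; split.
  apply/eqP=> ab; move: pw; rewrite ab /= => /andP[/andP[+ _] _].
  by move/Z.ltb_lt; rewrite /det; lia.
apply/negP => a_s; move: pw; rewrite pairwise_cons => /andP[/allP/(_ _ a_s) + _].
by move/Z.ltb_lt; rewrite /det; lia.
Qed.

End ConvexPosition.

From mathcomp Require Import ring lra.

(** * Convex hulls in the real plane *)

Section Bridge.
Local Open Scope classical_set_scope.
Local Open Scope ring_scope.
Local Open Scope convex_scope.
Local Open Scope card_scope.
Import GRing.Theory Num.Theory Order.TTheory.

Variable R : realType.
Local Notation plane := 'rV[R]_2.
Implicit Types (A B C P : set plane) (x y z : plane).

Lemma convex_setE C : convex_set (C : set (convex_lmodType plane)) <->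
  forall y z (t : R), C y -> C z -> 0 <= t -> t <= 1 -> C (t *: y + (1 - t) *: z).
Proof.
split=> cC y z t.
  move=> Cy Cz t0 t1; have := cC y z (Itv01 t0 t1) (mem_set Cy) (mem_set Cz).
  by move/set_mem.
move=> /set_mem Cy /set_mem Cz; apply/mem_set.
exact: cC Cy Cz (ge0 t) (le1 t).
Qed.

Lemma verticesE P x : vertices P x <-> P x /\
  forall y z (t : R), P y -> P z -> 0 < t < 1 -> x = t *: y + (1 - t) *: z ->
    y = x /\ z = x.
Proof.
split=> -[Px ext]; split=> // y z t Py Pz t01 E; last exact: (ext y z t%:num).
case/andP: (t01) => /ltW t0 /ltW t1.
exact: (ext y z (Itv01 t0 t1)).
Qed.

Lemma convex_hull_convex A : convex_set (convex_hull A : set (convex_lmodType plane)).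
Proof.
move=> y z t /set_mem Ay /set_mem Az; apply/mem_set => C [cC AC].
by apply/set_mem/cC; apply/mem_set; [apply: Ay | apply: Az].
Qed.

Lemma sub_convex_hull A : A `<=` convex_hull A.
Proof. exact: sub_gen_smallest. Qed.

Lemma convex_hull_min A C :
  (forall y z (t : R), C y -> C z -> 0 <= t -> t <= 1 -> C (t *: y + (1 - t) *: z)) ->
  A `<=` C -> convex_hull A `<=` C.
Proof. by move=> /convex_setE cC AC; apply: smallest_sub. Qed.

Lemma convex_hullP A y z (t : R) : convex_hull A y -> convex_hull A z ->
  0 <= t -> t <= 1 -> convex_hull A (t *: y + (1 - t) *: z).
Proof. exact: (convex_setE _).1 (@convex_hull_convex A) y z t. Qed.

Lemma convex_hull_sub A B : A `<=` convex_hull B -> convex_hull A `<=` convex_hull B.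
Proof. by move=> AB; apply: convex_hull_min AB => *; apply: convex_hullP. Qed.

Lemma convex_hullU1 A x :
  convex_hull (convex_hull A `|` [set x]) = convex_hull (A `|` [set x]).
Proof.
apply/seteqP; split; apply: convex_hull_sub.
  move=> y [Ay|->]; last by apply: sub_convex_hull; right.
  by apply: convex_hull_sub Ay => z Az; apply: sub_convex_hull; left.
move=> y [Ay|->]; apply: sub_convex_hull; last by right.
by left; apply: sub_convex_hull.
Qed.

(** An extreme point can be removed from a convex set without destroying
    convexity, so that it cannot be generated by other points. *)
Lemma vertex_convex_setD1 P x y z (t : R) : convex_set (P : set (convex_lmodType plane)) ->
  vertices P x -> P y -> y <> x -> P z -> z <> x -> 0 <= t -> t <= 1 ->
  P (t *: y + (1 - t) *: z) /\ t *: y + (1 - t) *: z <> x.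
Proof.
move=> /convex_setE cP /verticesE[Px ext] Py yx Pz zx t0 t1; split; first exact: cP.
have [->|t_neq0] := eqVneq t 0; first by rewrite scale0r add0r subr0 scale1r.
have [->|t_neq1] := eqVneq t 1; first by rewrite subrr scale0r addr0 scale1r.
have t01 : 0 < t < 1 by rewrite lt_def t_neq0 t0 lt_neqAle t_neq1.
by move=> /esym/(ext y z t Py Pz t01)[/yx].
Qed.

Lemma vertices_convex_hull A : vertices (convex_hull A) `<=` A.
Proof.
move=> x Vx; apply: contrapT => nAx.
suff /(_ x) : convex_hull A `<=` [set y | convex_hull A y /\ y <> x].
  by case=> //; case: Vx.
apply: convex_hull_min => [y z t [Ay yx] [Az zx]|y Ay].
  exact: vertex_convex_setD1 (@convex_hull_convex A) Vx Ay yx Az zx.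
by split; [exact: sub_convex_hull | move=> yx; apply: nAx; rewrite -yx].
Qed.

(** Weighted version of convexity: the weights need not sum to one. *)
Lemma convex_weights C y z (a b : R) :
  (forall y z (t : R), C y -> C z -> 0 <= t -> t <= 1 -> C (t *: y + (1 - t) *: z)) ->
  C y -> C z -> 0 <= a -> 0 <= b -> 0 < a + b ->
  C ((a + b)^-1 *: (a *: y + b *: z)).
Proof.
move=> cC Cy Cz a0 b0 ab.
have -> : (a + b)^-1 *: (a *: y + b *: z) = (a / (a + b)) *: y + (1 - a / (a + b)) *: z.
  rewrite scalerDr !scalerA ![_^-1 * _]mulrC; congr (_ + _ *: _).
  by field; rewrite gt_eqF.
apply: cC => //; first by rewrite divr_ge0 // ltW.
by rewrite ler_pdivrMr // mul1r lerDl.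
Qed.

(** A point outside the hull of [B] becomes extreme when it is added to [B]: the
    new hull consists of segments from that point to the old hull. *)
Lemma vertex_of_notin_hull B x : ~ convex_hull B x ->
  vertices (convex_hull (B `|` [set x])) x.
Proof.
move=> nBx.
pose H := convex_hull B.
have cH : forall y z (t : R), H y -> H z -> 0 <= t -> t <= 1 -> H (t *: y + (1 - t) *: z).
  by move=> *; apply: convex_hullP.
pose J := [set w | w = x \/ exists y (t : R),
  [/\ H y, 0 <= t, t < 1 & w = t *: x + (1 - t) *: y]].
(* the convex combination of two points of two segments issued from [x] *)
have comb (y z : plane) (a b t : R) :
    t *: (a *: x + (1 - a) *: y) + (1 - t) *: (b *: x + (1 - b) *: z) =
    (1 - (t * (1 - a) + (1 - t) * (1 - b))) *: x +
    (t * (1 - a) *: y + (1 - t) * (1 - b) *: z).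
  rewrite !scalerDr !scalerA addrACA -scalerDl; congr (_ *: _ + _); ring.
have segment (y z : plane) (a b t : R) : H y -> H z -> 0 <= a -> a < 1 -> 0 <= b -> b < 1 ->
    0 <= t -> t <= 1 -> exists2 w, H w & exists2 u, 0 <= u < 1 &
    t *: (a *: x + (1 - a) *: y) + (1 - t) *: (b *: x + (1 - b) *: z) =
    u *: x + (1 - u) *: w.
  move=> Hy Hz a0 a1 b0 b1 t0 t1; rewrite comb.
  have w1 : 0 <= t * (1 - a) by rewrite mulr_ge0 // subr_ge0 ltW.
  have w2 : 0 <= (1 - t) * (1 - b) by rewrite mulr_ge0 // subr_ge0 // ltW.
  set c := t * (1 - a) in w1 *; set d := (1 - t) * (1 - b) in w2 *.
  have cd : 0 < c + d.
    rewrite /c /d; have [->|t_neq0] := eqVneq t 0.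
      by rewrite mul0r add0r subr0 mul1r subr_gt0.
    by rewrite ltr_pwDl // mulr_gt0 ?subr_gt0 // lt_def t_neq0.
  have cd1 : c + d <= 1.
    have : c <= t by rewrite /c ler_piMr // gerBl.
    have : d <= 1 - t by rewrite /d ler_piMr ?subr_ge0 // gerBl.
    by move: c d {w1 w2 cd} => c d; lra.
  exists ((c + d)^-1 *: (c *: y + d *: z)); first exact: convex_weights.
  exists (1 - (c + d)); first by rewrite subr_ge0 cd1 gtrBl cd.
  by rewrite subKr scalerA divff ?scale1r // gt_eqF.
have half_segment (z : plane) (b t : R) : H z -> 0 <= b -> b < 1 -> 0 <= t -> t <= 1 ->
    J (t *: x + (1 - t) *: (b *: x + (1 - b) *: z)).
  move=> Hz b0 b1 t0 t1; have [->|t_neq1] := eqVneq t 1.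
    by left; rewrite subrr scale0r addr0 scale1r.
  have {}t1 : t < 1 by rewrite lt_neqAle t_neq1.
  right; exists z, (t + (1 - t) * b); split=> //.
  - by rewrite addr_ge0 // mulr_ge0 // subr_ge0 ltW.
  - have : 0 < (1 - t) * (1 - b) by rewrite mulr_gt0 ?subr_gt0.
    by move=> ?; nra.
  - by rewrite scalerDr !scalerA addrA -scalerDl; congr (_ + _ *: _); ring.
have cJ : forall y z (t : R), J y -> J z -> 0 <= t -> t <= 1 -> J (t *: y + (1 - t) *: z).
  move=> y z t [->|[y' [a [Hy a0 a1 ->]]]] [->|[z' [b [Hz b0 b1 ->]]]] t0 t1.
  - by left; rewrite -scalerDl addrC subrK scale1r.
  - exact: half_segment.
  - rewrite addrC -{2}[t](subKr 1); apply: half_segment => //; first by rewrite subr_ge0.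
    by rewrite gerBl.
  - have [w Hw [u /andP[u0 u1] ->]] := segment y' z' a b t Hy Hz a0 a1 b0 b1 t0 t1.
    by right; exists w, u.
have hullJ : convex_hull (B `|` [set x]) `<=` J.
  apply: convex_hull_min cJ _ => y [By|->]; last by left.
  right; exists y, 0; split=> //; first exact: sub_convex_hull.
  by rewrite scale0r add0r subr0 scale1r.
apply/verticesE; split; first by apply: sub_convex_hull; right.
move=> y z t /hullJ Jy /hullJ Jz /andP[t0 t1] E.
have t_neq0 : t != 0 by rewrite gt_eqF.
have t_neq1 : 1 - t != 0 by rewrite subr_eq0 eq_sym lt_eqF.
have fix_y : y = x -> z = x.
  move=> yx; apply: (scalerI t_neq1); apply: (addrI (t *: x)).
  by rewrite -{1}yx -E -scalerDl addrC subrK scale1r.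
have fix_z : z = x -> y = x.
  move=> zx; apply: (scalerI t_neq0); apply: (addIr ((1 - t) *: x)).
  by rewrite -{1}zx -E -scalerDl addrC subrK scale1r.
case: Jy => [yx|[y' [a [Hy a0 a1 yE]]]]; first by split=> //; apply: fix_y.
case: Jz => [zx|[z' [b [Hz b0 b1 zE]]]]; first by split=> //; apply: fix_z.
have [w Hw [u /andP[u0 u1] wE]] :=
  segment y' z' a b t Hy Hz a0 a1 b0 b1 (ltW t0) (ltW t1).
case: nBx; suff <- : w = x by [].
have u_neq1 : 1 - u != 0 by rewrite subr_eq0 eq_sym lt_eqF.
apply: (scalerI u_neq1); apply: (addrI (u *: x)).
by rewrite -wE -yE -zE -E -scalerDl addrC subrK scale1r.
Qed.

(** A polygon is the hull of its vertices: non-extreme generators can be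
    discarded one at a time. *)
Lemma convex_hull_vertices A : finite_set A ->
  convex_hull (vertices (convex_hull A)) = convex_hull A.
Proof.
move=> /finite_seqP[s {A}->]; have [n] := ubnP (size s).
elim: n s => // n IHn s lt_sn.
pose B x := [set` [seq y <- s | y != x]].
have sE x : x \in s -> [set` s] = B x `|` [set x].
  move=> xs; apply/seteqP; split=> y /=.
    move=> ys; have [->|yx] := eqVneq y x; first by right.
    by left; rewrite /B /= mem_filter yx.
  by case=> [|->//]; rewrite /B /= mem_filter => /andP[].
have [all_ext|/existsNP[x /not_implyP[xs /contrapT Bx]]] :=
    pselect (forall x, x \in s -> ~ convex_hull (B x) x).
  apply/seteqP; split; apply: convex_hull_sub => x; first by case.
  move=> /= xs; apply: sub_convex_hull.
  by rewrite (sE x xs); apply: vertex_of_notin_hull; apply: all_ext.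
have -> : convex_hull [set` s] = convex_hull (B x).
  rewrite (sE x xs); apply/seteqP; split; apply: convex_hull_sub => y.
    by case=> [|->//]; apply: sub_convex_hull.
  by move=> By; apply: sub_convex_hull; left.
apply: IHn; apply: (@leq_trans (size s)); last by rewrite -ltnS.
rewrite size_filter -(count_predC (fun y => y != x) s) -[X in (X < _)%N]addn0.
by rewrite ltn_add2l -has_count; apply/hasP; exists x; rewrite //= negbK.
Qed.

Lemma card_set_seq (T : choiceType) (s : seq T) : uniq s -> [set` s] #= `I_(size s).
Proof.
elim: s => [|x s IHs] /=; first by move=> _; rewrite set_nil II0.
move=> /andP[xs Us]; apply/eq_cardSP; exists x; first exact: mem_head.
suff -> : [set` x :: s] `\ x = [set` s] by apply: IHs.
apply/seteqP; split=> y /=; first by rewrite inE => -[/orP[/eqP|]].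
move=> ys; rewrite inE ys orbT; split=> // yx.
by move: xs; rewrite -yx ys.
Qed.

Lemma card_set_seqP (T : choiceType) (A : set T) n : A #= `I_n ->
  exists2 s, [set` s] = A & uniq s /\ size s = n.
Proof.
elim: n A => [|n IHn] A.
  by rewrite II0 card_eq0 => /eqP ->; exists [::] => //; rewrite set_nil.
move=> /eq_cardSP[x Ax /IHn[s sE [Us sz]]]; exists (x :: s).
  apply/seteqP; split=> y /=; rewrite inE.
    by case/orP => [/eqP-> //|ys]; have [] : (A `\ x) y by rewrite -sE.
  move=> Ay; have [//|yx] := eqVneq y x.
  by have : [set` s] y by rewrite sE; split=> // /eqP; apply/negP.
split; last by rewrite /= sz.
rewrite /= Us andbT; apply/negP => xs.
have [_] : (A `\ x) x by rewrite -sE.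
exact.
Qed.

(** * From lattice points to lattice polygons *)

Definition zr (z : Z) : R := (int_of_Z z)%:~R.

Lemma zrD u v : zr (Z.add u v) = zr u + zr v.
Proof. by rewrite /zr -intrD -(rmorphD int_of_Z). Qed.
Lemma zrN u : zr (Z.opp u) = - zr u.
Proof. by rewrite /zr -intrN -(rmorphN int_of_Z). Qed.
Lemma zrB u v : zr (Z.sub u v) = zr u - zr v.
Proof. by rewrite -Z.add_opp_r zrD zrN. Qed.
Lemma zrM u v : zr (Z.mul u v) = zr u * zr v.
Proof. by rewrite /zr -intrM -(rmorphM int_of_Z). Qed.
Lemma zr_gt0 u : Z.lt Z0 u -> 0 < zr u.
Proof. by rewrite /zr ltr0z; case: u => //= p; lia. Qed.
Lemma zr_ge0 u : Z.le Z0 u -> 0 <= zr u.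
Proof. by rewrite /zr ler0z; case: u. Qed.
Lemma zr_inj : injective zr.
Proof. by move=> u v /intr_inj; apply: (can_inj int_of_ZK). Qed.

Definition emb (p : pt) : plane := \row_j zr (if j == 0 then p.1 else p.2).

Lemma emb0 p : emb p 0 0 = zr p.1. Proof. by rewrite mxE. Qed.
Lemma emb1 p : emb p 0 1 = zr p.2. Proof. by rewrite mxE. Qed.

Lemma rowP2 (v w : plane) : v 0 0 = w 0 0 -> v 0 1 = w 0 1 -> v = w.
Proof.
move=> E0 E1; apply/rowP => -[[|[|//]] lt_j]; [move: E0 | move: E1];
  by congr (v _ _ = w _ _); apply: val_inj.
Qed.

Lemma emb_inj : injective emb.
Proof.
move=> [px py] [qx qy] E; congr (_, _); apply: zr_inj.
  by rewrite -(emb0 (px, py)) E emb0.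
by rewrite -(emb1 (px, py)) E emb1.
Qed.

Lemma emb_lattice p : @integer_lattice R (emb p).
Proof.
exists (\row_j int_of_Z (if j == 0 then p.1 else p.2)) => //.
by apply/rowP => j; rewrite !mxE.
Qed.

Lemma lattice_emb x : @integer_lattice R x -> exists p, x = emb p.
Proof.
case=> v _ <-; exists (Z_of_int (v 0 0), Z_of_int (v 0 1)).
by apply: rowP2; rewrite !mxE /zr /= Z_of_intK.
Qed.

Definition rdet (a b c : plane) : R :=
  (b 0 0 - a 0 0) * (c 0 1 - a 0 1) - (b 0 1 - a 0 1) * (c 0 0 - a 0 0).

Lemma rdet_emb a b c : rdet (emb a) (emb b) (emb c) = zr (det a b c).
Proof. by rewrite /rdet !emb0 !emb1 /det zrB !zrM !zrB. Qed.

Lemma rdet_conv a b y z (t : R) :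
  rdet a b (t *: y + (1 - t) *: z) = t * rdet a b y + (1 - t) * rdet a b z.
Proof. by rewrite /rdet !mxE; ring. Qed.

Definition pts (s : seq pt) : set plane := emb @` [set` s].
Definition hull (s : seq pt) : set plane := convex_hull (pts s).

Lemma eq_pts s t : s =i t -> pts s = pts t.
Proof. by move=> st; congr (_ @` _); apply/seteqP; split=> p /=; rewrite st. Qed.

Lemma pts_emb s p : pts s (emb p) -> p \in s.
Proof. by case=> q qs /emb_inj <-. Qed.

(** The function [f] below is affine: it adds the signed areas spanned with the two
    edges at the first point.  It vanishes there and is positive at the other
    points, so that it exposes the first point. *)
Lemma first_point_vertex a b u l :
  ccw (a :: b :: rcons u l) -> vertices (hull (a :: b :: rcons u l)) (emb a).
Proof.
move=> H; pose f z := rdet (emb a) (emb b) z + rdet (emb l) (emb a) z.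
have fa : f (emb a) = 0 by rewrite /f /rdet; ring.
have f_conv y z (t : R) : f (t *: y + (1 - t) *: z) = t * f y + (1 - t) * f z.
  by rewrite /f !rdet_conv; ring.
pose C := [set z | z = emb a \/ 0 < f z].
have fC z : C z -> 0 <= f z by case=> [->|/ltW //]; rewrite fa.
have hullC : hull (a :: b :: rcons u l) `<=` C.
  apply: convex_hull_min => [y z t Cy Cz t0 t1|z [p ps <-]]; last first.
    rewrite /C /= /f !rdet_emb -zrD.
    move: ps; rewrite /= inE => /orP[/eqP ->|ps]; [by left | right].
    apply: zr_gt0; move/andP: H => [/andP[/allP ab pw] _].
    have abl : Z.lt Z0 (det a b l) by apply/Z.ltb_lt/ab; rewrite mem_rcons mem_head.
    have lab : det l a b = det a b l := detC l a b.
    move: ps; rewrite inE mem_rcons inE => /or3P[/eqP->|/eqP->|pu].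
    - by move: abl lab; rewrite /det; lia.
    - by move: abl; rewrite /det; lia.
    - have : Z.lt Z0 (det a b p) by apply/Z.ltb_lt/ab; rewrite mem_rcons inE pu orbT.
      have : Z.lt Z0 (det l a p).
        rewrite detC; apply/Z.ltb_lt; move: (pw : pairwise _ (rcons u l)).
        rewrite pairwise_rcons => /andP[/allP + _].
        exact.
      lia.
  have [->|t_neq0] := eqVneq t 0; first by rewrite scale0r add0r subr0 scale1r.
  have [->|t_neq1] := eqVneq t 1; first by rewrite subrr scale0r addr0 scale1r.
  have tp : 0 < t by rewrite lt_def t_neq0.
  have tp' : 0 < 1 - t by rewrite subr_gt0 lt_neqAle t_neq1.
  case: Cy (fC _ Cy) => [->|fy] fy0; case: Cz (fC _ Cz) => [->|fz] fz0.
  - by left; rewrite -scalerDl addrC subrK scale1r.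
  - by right; rewrite f_conv ltr_wpDl ?mulr_gt0 ?mulr_ge0.
  - by right; rewrite f_conv ltr_pwDl ?mulr_gt0 ?mulr_ge0 // ltW.
  - by right; rewrite f_conv addr_gt0 ?mulr_gt0.
apply/verticesE; split.
  by apply: sub_convex_hull; exists a => //=; rewrite mem_head.
move=> y z t /hullC Cy /hullC Cz /andP[t0 t1] E.
have tp' : 0 < 1 - t by rewrite subr_gt0.
have : t * f y + (1 - t) * f z = 0 by rewrite -f_conv -E.
case: Cy (fC _ Cy) => [->|fy] fy0; case: Cz (fC _ Cz) => [->|fz] fz0 // E0; exfalso.
- have : 0 < t * f (emb a) + (1 - t) * f z by rewrite ltr_wpDl ?mulr_gt0 ?mulr_ge0 // ltW.
  by rewrite E0 ltxx.
- have : 0 < t * f y + (1 - t) * f (emb a) by rewrite ltr_pwDl ?mulr_gt0 ?mulr_ge0 // ltW.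
  by rewrite E0 ltxx.
- have : 0 < t * f y + (1 - t) * f z by rewrite addr_gt0 ?mulr_gt0.
  by rewrite E0 ltxx.
Qed.

Lemma vertices_hull s : (2 < size s)%N -> ccw s -> vertices (hull s) = pts s.
Proof.
move=> sz H; apply/seteqP; split; first exact: vertices_convex_hull.
move=> _ [p ps <-]; have [i [|b t] rot_s] := rot_to ps.
  by move: sz; rewrite -(size_rot i) rot_s.
have hull_s : hull s = hull (p :: b :: t).
  by congr convex_hull; apply: eq_pts => q; rewrite -rot_s mem_rot.
rewrite hull_s; have H' : ccw (p :: b :: t) by rewrite -rot_s ccw_rot.
case: (lastP t) H' rot_s {hull_s} => [|u l] H' rot_s; last exact: first_point_vertex.
by move: sz; rewrite -(size_rot i) rot_s.
Qed.

Lemma row_free_rdet (a b c : plane) : 0 < rdet a b c ->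
  row_free (col_mx (b - a) (c - a)).
Proof.
move=> D; apply: inj_row_free => w; rewrite -[w]hsubmxK mul_row_col.
rewrite [lsubmx w]mx11_scalar [rsubmx w]mx11_scalar !mul_scalar_mx.
set x := lsubmx w 0 0; set y := rsubmx w 0 0 => E.
have := congr1 (fun v : plane => v 0 0) E; have := congr1 (fun v : plane => v 0 1) E.
rewrite !mxE => E1 E0.
have x0 : x = 0.
  apply: (mulIf (lt0r_neq0 D)); rewrite mul0r /rdet.
  transitivity ((c 0 1 - a 0 1) * (x * (b 0 0 - a 0 0) + y * (c 0 0 - a 0 0)) -
    (c 0 0 - a 0 0) * (x * (b 0 1 - a 0 1) + y * (c 0 1 - a 0 1))); first by ring.
  by rewrite E0 E1 !mulr0 subrr.
have y0 : y = 0.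
  apply: (mulIf (lt0r_neq0 D)); rewrite mul0r /rdet.
  transitivity ((b 0 0 - a 0 0) * (x * (b 0 1 - a 0 1) + y * (c 0 1 - a 0 1)) -
    (b 0 1 - a 0 1) * (x * (b 0 0 - a 0 0) + y * (c 0 0 - a 0 0))); first by ring.
  by rewrite E0 E1 !mulr0 subrr.
by rewrite x0 y0 !raddf0 row_mx0.
Qed.

Lemma hull_two_dimensional s : (2 < size s)%N -> ccw s -> two_dimensional (hull s).
Proof.
case: s => [|a [|b [|c s]]] // _ H.
exists (emb a), (emb b), (emb c); split.
- by apply: sub_convex_hull; exists a => //=; rewrite !inE eqxx.
- by apply: sub_convex_hull; exists b => //=; rewrite !inE eqxx orbT.
- by apply: sub_convex_hull; exists c => //=; rewrite !inE eqxx !orbT.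
apply: row_free_rdet; rewrite rdet_emb; apply: zr_gt0; apply/Z.ltb_lt.
by case/andP: H => /andP[/andP[]].
Qed.

Lemma hull_lattice_polygon s : (2 < size s)%N -> ccw s -> lattice_polygon (hull s).
Proof.
move=> sz H; split; last by rewrite vertices_hull // => _ [p _ <-]; apply: emb_lattice.
split; last exact: hull_two_dimensional.
by exists (pts s) => //; apply: finite_image; apply: finite_seq.
Qed.

Lemma hull_has_n_vertices s : (2 < size s)%N -> ccw s ->
  has_n_vertices (size s) (hull s).
Proof.
move=> sz H; rewrite /has_n_vertices /= vertices_hull //.
have -> : pts s = [set` map emb s].
  apply/seteqP; split=> [_ [p ps <-]|x /mapP[p ps ->]]; first exact: map_f.
  by exists p.
rewrite -(size_map emb); apply: card_set_seq.
by rewrite map_inj_uniq ?ccw_uniq //; apply: emb_inj.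
Qed.

(** If the new point belonged to the hull of [s], both hulls would have the same
    vertices. *)
Lemma insertion_hull s h : (2 < size s)%N -> size h = (size s).+1 ->
  ccw s -> ccw h -> {subset s <= h} -> insertion_move (hull s) (hull h).
Proof.
move=> sz szh Hs Hh sh; have szh2 : (2 < size h)%N by rewrite szh ltnW.
have Us := ccw_uniq sz Hs; have Uh := ccw_uniq szh2 Hh.
have [/allP hs|/allPn[p ph ps]] := boolP (all (mem s) h).
  by have := uniq_leq_size Uh hs; rewrite szh ltnn.
have hE : p :: s =i h.
  apply: (uniq_min_size _ _ _).2; rewrite /= ?ps ?szh //.
  by move=> q; rewrite inE => /orP[/eqP->|/sh].
have ptsE : pts h = pts s `|` [set emb p].
  apply/seteqP; split=> x.
    by case=> q; rewrite /= -hE inE => /orP[/eqP->|qs] <-; [right | left; exists q].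
  by case=> [[q /sh qh <-]|->]; [exists q | exists p].
have hullE : hull h = convex_hull (hull s `|` [set emb p]).
  by rewrite /hull ptsE convex_hullU1.
exists (emb p) => //; split; last by rewrite -hullE !vertices_hull.
move=> sp; have : pts s (emb p).
  rewrite -vertices_hull //; suff -> : hull s = hull h.
    by rewrite vertices_hull // ptsE; right.
  apply/seteqP; split; apply: convex_hull_sub => x.
    by case=> q /sh qh <-; apply: sub_convex_hull; exists q.
  by rewrite ptsE => -[xs|->//]; apply: sub_convex_hull.
by move/pts_emb; apply/negP.
Qed.

Local Notation Gamma := (induced (Lambda2 R) (has_n_vertices 5 `|` has_n_vertices 6)).

Lemma adj_sym P Q : adj Gamma P Q -> adj Gamma Q P.
Proof. by move=> [nP nQ [lP lQ mv]]; split=> //; split=> //; case: mv; [right | left]. Qed.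

Lemma hull_adj s h : pentagon s -> ccw h -> size h = 6%N -> {subset s <= h} ->
  adj Gamma (hull s) (hull h).
Proof.
move=> /andP[Hs /eqP szs] Hh szh sh; split.
- by left; rewrite -szs; apply: hull_has_n_vertices; rewrite ?szs.
- by right; rewrite -szh; apply: hull_has_n_vertices; rewrite ?szh.
split; try by apply: hull_lattice_polygon; rewrite ?szs ?szh.
by left; apply: insertion_hull => //; rewrite ?szs ?szh.
Qed.

Lemma hull_path s h : pentagon s -> ccw h -> (size h <= 6)%N -> {subset s <= h} ->
  clos_refl_trans _ (adj Gamma) (hull s) (hull h) /\
  clos_refl_trans _ (adj Gamma) (hull h) (hull s).
Proof.
move=> Ps Hh szh sh; have /andP[Hs /eqP szs] := Ps.
have Us : uniq s by apply: ccw_uniq; rewrite ?szs.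
have [szh6|] := eqVneq (size h) 6%N.
  have sh_adj := hull_adj Ps Hh szh6 sh.
  by split; apply: rt_step => //; apply: adj_sym.
rewrite neq_ltn [(6 < _)%N]ltnNge szh orbF ltnS => szh5.
suff -> : hull s = hull h by split; apply: rt_refl.
by congr convex_hull; apply: eq_pts; apply: (uniq_min_size Us sh _).2; rewrite szs.
Qed.

Lemma joined_path s t : joined s t ->
  clos_refl_trans _ (adj Gamma) (hull s) (hull t).
Proof.
elim=> [u v [Pu Pv [h /andP[Hh szh] [uh vh]]]|u|u v w _ uv _ vw].
- apply: rt_trans (hull_path Pu Hh szh uh).1 (hull_path Pv Hh szh vh).2.
- exact: rt_refl.
- exact: rt_trans uv vw.
Qed.

(** Barycentric coordinates with respect to other points would contradict
    extremality. *)
Lemma vertices_independent s P : convex_set (P : set (convex_lmodType plane)) ->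
  vertices P = pts s -> convexly_independent s.
Proof.
move=> cP VP p q r m ps qs rs ms a b c a0 b0 c0 abc E1 E2.
apply: contrapT => /negP; rewrite !inE !negb_or => /and3P[mp mq mr].
have Vm : vertices P (emb m) by rewrite VP; exists m.
pose C := [set y | P y /\ y <> emb m].
have cC : forall y z (t : R), C y -> C z -> 0 <= t -> t <= 1 -> C (t *: y + (1 - t) *: z).
  by move=> y z t [Py ym] [Pz zm] t0 t1; apply: vertex_convex_setD1 cP Vm Py ym Pz zm t0 t1.
have inC k : k \in s -> m != k -> C (emb k).
  move=> ks mk; split; last by move=> /emb_inj km; move: mk; rewrite km eqxx.
  by have [] : vertices P (emb k) by rewrite VP; exists k.
have [[Cp Cq] Cr] := (inC p ps mp, inC q qs mq, inC r rs mr).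
pose S : plane := zr a *: emb p + zr b *: emb q + zr c *: emb r.
have ES : emb m = (zr a + zr b + zr c)^-1 *: S.
  have abcR : zr a + zr b + zr c != 0 by rewrite -!zrD gt_eqF // zr_gt0.
  apply: (scalerI abcR); rewrite scalerA divff // scale1r.
  have entry (j : 'I_2) :
      S 0 j = zr a * emb p 0 j + zr b * emb q 0 j + zr c * emb r 0 j by rewrite !mxE.
  apply: rowP2; rewrite [LHS]mxE entry ?emb0 ?emb1 -!zrD -!zrM -!zrD; congr zr.
    exact: E1.
  exact: E2.
suff [_] : C (emb m) by apply.
have [[za zb] zc] := (zr_ge0 a0, zr_ge0 b0, zr_ge0 c0).
have zabc : 0 < zr a + zr b + zr c by rewrite -!zrD; apply: zr_gt0.
rewrite ES /S; have [ab_le0|ab_gt0] := leP (zr a + zr b) 0.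
  have za0 : zr a = 0.
    by apply/eqP; rewrite eq_le za andbT; apply: le_trans ab_le0; rewrite lerDl.
  have zb0 : zr b = 0.
    by apply/eqP; rewrite eq_le zb andbT; apply: le_trans ab_le0; rewrite lerDr.
  rewrite za0 zb0 !scale0r !add0r in zabc *.
  by rewrite scalerA mulVf ?scale1r ?gt_eqF.
have -> : zr a *: emb p + zr b *: emb q =
    (zr a + zr b) *: ((zr a + zr b)^-1 *: (zr a *: emb p + zr b *: emb q)).
  by rewrite scalerA divff ?scale1r ?gt_eqF.
apply: convex_weights => //; last exact: ltW.
exact: convex_weights.
Qed.

Lemma lattice_polygon_hull P n : (2 < n)%N -> lattice_polygon P -> has_n_vertices n P ->
  exists s, [/\ ccw s, size s = n & P = hull s].
Proof.
move=> n2 [[[A Afin PA] _] lat] /card_set_seqP[vs vsE [Uvs szvs]].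
have [s vsmap] : exists s, vs = map emb s.
  have : {in vs, forall x, exists p, x = emb p}.
    by move=> x xvs; apply/lattice_emb/lat; rewrite -vsE.
  elim: (vs) => [|x us IHus] us_emb; first by exists [::].
  have [p ->] := us_emb x (mem_head _ _).
  have [y yus|t ->] := IHus; first by apply: us_emb; rewrite inE yus orbT.
  by exists (p :: t).
have VP : vertices P = pts s.
  rewrite -vsE vsmap; apply/seteqP; split=> [x /mapP[p ps ->]|_ [p ps <-]].
    by exists p.
  exact: map_f.
have cP : convex_set (P : set (convex_lmodType plane)) by rewrite PA; apply: convex_hull_convex.
have Us : uniq s by move: Uvs; rewrite vsmap => /map_uniq.
have [t /[dup] ts /perm_mem t_s Ht] := ccw_enumeration Us (vertices_independent cP VP).
exists t; split=> //; first by rewrite (perm_size ts) -szvs vsmap size_map.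
by rewrite /hull (eq_pts t_s) -VP PA convex_hull_vertices.
Qed.

Lemma path_to_pentagon P : nodes Gamma P -> exists2 s, pentagon s &
  clos_refl_trans _ (adj Gamma) P (hull s) /\ clos_refl_trans _ (adj Gamma) (hull s) P.
Proof.
case=> lP nP; have [s [Hs szs ->]] :
    exists s, [/\ ccw s, size s = 5%N \/ size s = 6%N & P = hull s].
  by case: nP => /(lattice_polygon_hull _ lP)[//|s [Hs szs ->]]; exists s; split; auto.
have Ps : pentagon (take 5 s).
  rewrite /pentagon size_take; case: szs => -> //=; rewrite andbT;
  exact: subseq_ccw (take_subseq _ _) Hs.
exists (take 5 s) => //.
have [|to_s of_s] := hull_path Ps Hs _ (mem_subseq (take_subseq _ _)); last by split.
by case: szs => ->.
Qed.

End Bridge.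

Local Open Scope classical_set_scope.

Theorem theorem1p5 (R : realType) :
  connected_graph
    (induced (Lambda2 R) (has_n_vertices 5 `|` has_n_vertices 6)).
Proof.
split=> [|P Q /path_to_pentagon[s Ps [P_s _]] /path_to_pentagon[t Pt [_ t_Q]]].
  exists (@hull R base); split; first exact: hull_lattice_polygon.
  by left; apply: (@hull_has_n_vertices R base).
apply: rt_trans P_s _; apply: rt_trans t_Q.
by apply: joined_path; apply: pentagons_connected.
Qed.
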